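(* For each $i\in\{1,2,3,5,6,7,8,9\}$, let $\mathsf{Props}_i$ be the set of properties given in the context, let $\Sigma_i$ be the signature consisting of the operation and relation symbols occurring in $\mathsf{Props}_i$, and let $\mathit{cr}_i=(\underline{\mathcal B},T,\underline{\mathcal C}_i,J_i,R_i)$, where: (a) $\underline{\mathcal B}$ is the category of $\Sigma_{\mathsf{dtor}}$-models and $T=\mathcal{T}r_\infty(\Sigma_{\mathsf{dtor}})$; (b) $\underline{\mathcal C}_i$ is the category of $(\Sigma_i,\mathsf{Props}_i)$-models (with $\Sigma_i$-model morphisms) and $J_i=\mathcal{T}r_\infty(\Sigma_i)$; (c) $R_i:\underline{\mathcal C}_i\to\underline{\mathcal B}$ is the forgetful functor sending $(\Sigma_i,\mathsf{Props}_i)$-models to their underlying $\Sigma_{\mathsf{dtor}}$-models. Then, for every $i\in\{1,2,3,5,6,7,8,9\}$, $\mathit{cr}_i$ is an epi-corecursor. In particular, $\mathcal{T}r_\infty(\Sigma_i)$ is the final $(\Sigma_i,\mathsf{Props}_i)$-model.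
   Context: **Epi-corecursors.** An epi-corecursor is a tuple $\mathit{cr}=(\underline{\mathcal B},T,\underline{\mathcal C},J,R)$ where $\underline{\mathcal B}$ is a category (base category), $T$ is an object of $\underline{\mathcal B}$ (base object), $\underline{\mathcal C}$ is a category (extended category), $J$ is a final object of $\underline{\mathcal C}$, and $R:\underline{\mathcal C}\to\underline{\mathcal B}$ is a functor with $R\,J=T$. **Infinitary terms (iterms).** $\mathsf{Var}$ is a set of variables of cardinality $\aleph_1$. $\mathsf{Perm}$ is the set of bijections $\sigma:\mathsf{Var}\to\mathsf{Var}$ with $\mathsf{supp}\,\sigma=\{x\mid\sigma\,x\neq x\}$ finite; $x\leftrightarrow y$ is the transposition; for variables, $x[\sigma]=\sigma\,x$, $x[z_1\wedge z_2]=(z_1\leftrightarrow z_2)(x)$, and $x[y/z]$ is $y$ if $x=z$ and $x$ otherwise. Pre-iterms are the possibly infinite trees given by the grammar $p::=\mathsf{PVr}\,x\mid\mathsf{PAp}\,p_1\,p_2\mid\mathsf{PLm}\,x\,p$ interpreted coinductively (the final coalgebra of the set functor $A\mapsto\mathsf{Var}+A\times A+\mathsf{Var}\times A$). On pre-iterms, swapping $p[z_1\wedge z_2]$ and permutation $p[\sigma]$ are defined corecursively by applying the swap/permutation to every variable, including binding ones. Freshness $z\,\#\,p$ is the largest relation such that $z\,\#\,p$ implies: $p=\mathsf{PVr}\,x$ with $z\neq x$; or $p=\mathsf{PAp}\,p_1\,p_2$ with $z\,\#\,p_1$ and $z\,\#\,p_2$; or $p=\mathsf{PLm}\,x\,p'$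 with $z=x$ or $z\,\#\,p'$. $\alpha$-equivalence $\equiv$ is the largest relation such that $p\equiv q$ implies: $p=\mathsf{PVr}\,x=q$ for some $x$; or $p=\mathsf{PAp}\,p_1\,p_2$, $q=\mathsf{PAp}\,q_1\,q_2$ with $p_1\equiv q_1$, $p_2\equiv q_2$; or $p=\mathsf{PLm}\,x\,p'$, $q=\mathsf{PLm}\,y\,q'$ and for some $z$, ($z=x$ or $z\,\#\,p'$), ($z=y$ or $z\,\#\,q'$) and $p'[z\wedge x]\equiv q'[z\wedge y]$. It is an equivalence compatible with the constructors, swapping, permutation and freshness. The set of iterms is $\mathsf{Tr}_\infty=$ pre-iterms$/\equiv$, with the induced constructors $\mathsf{Vr},\mathsf{Ap},\mathsf{Lm}$, swapping, permutation and freshness; $\mathsf{FV}\,t=\{x\mid\neg\,x\,\#\,t\}$. Capture-avoiding substitution $t[s/z]$ is the unique operator with $(\mathsf{Vr}\,x)[s/z]=$ (if $x=z$ then $s$ else $\mathsf{Vr}\,x$), $(\mathsf{Ap}\,t_1\,t_2)[s/z]=\mathsf{Ap}(t_1[s/z])(t_2[s/z])$, and $(\mathsf{Lm}\,x\,t)[s/z]=\mathsf{Lm}\,x(t[s/z])$ if $x\neq z$ and $x\,\#\,s$; renaming is $t[y/z]=t[(\mathsf{Vr}\,y)/z]$. $\mathcal P_{\neq\emptyset}(A)$ is the set of nonempty subsets of $A$. For any set $M$, $\mathsf V,\mathsf A,\mathsf L$ denote the three injections into $\mathsf{Var}+M\times M+\mathcal P_{\neq\emptyset}(\mathsf{Var}\times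 M)$. The iterm destructor $\mathsf{Dest}:\mathsf{Tr}_\infty\to\mathsf{Var}+\mathsf{Tr}_\infty\times\mathsf{Tr}_\infty+\mathcal P_{\neq\emptyset}(\mathsf{Var}\times\mathsf{Tr}_\infty)$ is: $\mathsf{Dest}(\mathsf{Vr}\,x)=\mathsf V\,x$; $\mathsf{Dest}(\mathsf{Ap}\,t_1\,t_2)=\mathsf A(t_1,t_2)$; and $\mathsf{Dest}\,t=\mathsf L\{(x,t')\mid t=\mathsf{Lm}\,x\,t'\}$ if $t$ is a $\mathsf{Lm}$-abstraction. **Signatures and models.** Symbols: $\mathsf{dest},\mathsf{vr},\mathsf{pm},\mathsf{sw},\mathsf{sb},\mathsf{ren},\mathsf{fv},\mathsf{fr}$. $\Sigma_{\mathsf{dtor}}=\{\mathsf{dest}\}$; all signatures considered extend it. A $\Sigma$-model $\mathcal M$ has a carrier set $M$, an operation $\mathsf{Dest}^{\mathcal M}:M\to\mathsf{Var}+M\times M+\mathcal P_{\neq\emptyset}(\mathsf{Var}\times M)$, and for the other symbols in $\Sigma$: $\mathsf{vr}$: $\mathsf{Vr}^{\mathcal M}:\mathsf{Var}\to M$; $\mathsf{pm}$: $\_[\_]^{\mathcal M}:M\to\mathsf{Perm}\to M$; $\mathsf{sw}$: $\_[\_\wedge\_]^{\mathcal M}:M\to\mathsf{Var}\to\mathsf{Var}\to M$; $\mathsf{sb}$: $\_[\_/\_]^{\mathcal M}:M\to M\to\mathsf{Var}\to M$; $\mathsf{ren}$: $\_[\_/\_]^{\mathcal M}:M\to\mathsf{Var}\to\mathsf{Var}\to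 M$; $\mathsf{fv}$: $\mathsf{FV}^{\mathcal M}:M\to\mathcal P(\mathsf{Var})$; $\mathsf{fr}$: $\#^{\mathcal M}:\mathsf{Var}\to M\to\mathsf{Bool}$. A morphism $g:\mathcal M\to\mathcal M'$ is a function $g:M\to M'$ that commutes with the operations for $\mathsf{vr},\mathsf{pm},\mathsf{sw},\mathsf{sb},\mathsf{ren}$ in $\Sigma$, satisfies ($x\,\#^{\mathcal M}m$ implies $x\,\#^{\mathcal M'}g\,m$) if $\mathsf{fr}\in\Sigma$ and $\mathsf{FV}^{\mathcal M'}(g\,m)\subseteq\mathsf{FV}^{\mathcal M}m$ if $\mathsf{fv}\in\Sigma$, and sub-commutes with the destructor: for all $m\in M$, if $\mathsf{Dest}^{\mathcal M}m=\mathsf V\,x$ then $\mathsf{Dest}^{\mathcal M'}(g\,m)=\mathsf V\,x$; if $\mathsf{Dest}^{\mathcal M}m=\mathsf A(m_1,m_2)$ then $\mathsf{Dest}^{\mathcal M'}(g\,m)=\mathsf A(g\,m_1,g\,m_2)$; if $\mathsf{Dest}^{\mathcal M}m=\mathsf L\,K$ then $\mathsf{Dest}^{\mathcal M'}(g\,m)=\mathsf L\,K'$ for some $K'\supseteq\{(x,g\,m')\mid(x,m')\in K\}$. $\mathcal{T}r_\infty(\Sigma)$ is the $\Sigma$-model with carrier $\mathsf{Tr}_\infty$ and the standard operators on iterms. **Properties** (interpreted in a model, superscripts omitted; $t,t',t_1,t_2,s,u$ range over the carrier $M$; $x,x',x_i,y,y_i,z,z_i$ over $\mathsf{Var}$;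 $\sigma,\tau$ over $\mathsf{Perm}$; all universally quantified unless said otherwise; ''countable'' means at most countable). Swapping: SwVr$_\infty$: if $\mathsf{Dest}\,t=\mathsf V\,x$ then $\mathsf{Dest}(t[z_1\wedge z_2])=\mathsf V(x[z_1\wedge z_2])$. SwAp$_\infty$: if $\mathsf{Dest}\,t=\mathsf A(t_1,t_2)$ then $\mathsf{Dest}(t[z_1\wedge z_2])=\mathsf A(t_1[z_1\wedge z_2],t_2[z_1\wedge z_2])$. SwLm$_\infty$: if $\mathsf{Dest}\,t=\mathsf L\,K$ then there is $K'$ with $\mathsf{Dest}(t[z_1\wedge z_2])=\mathsf L\,K'$ and $(x[z_1\wedge z_2],t'[z_1\wedge z_2])\in K'$ for all $(x,t')\in K$. SwId: $t[z\wedge z]=t$. SwIv: $t[x\wedge y][x\wedge y]=t$. SwCp: $t[x\wedge y][z_1\wedge z_2]=(t[z_1\wedge z_2])[(x[z_1\wedge z_2])\wedge(y[z_1\wedge z_2])]$. SwFr: if $x\,\#\,t$ and $y\,\#\,t$ then $t[x\wedge y]=t$. FrSw: $z\,\#\,t[x\wedge y]$ iff $z[x\wedge y]\,\#\,t$. SwCg$_\infty$: if $\mathsf{Dest}\,t=\mathsf L\,K$ and $\{(x_1,t_1),(x_2,t_2)\}\subseteq K$ then there is $z$ with ($z=x_1$ or $z\,\#\,t_1$), ($z=x_2$ or $z\,\#\,t_2$) and $t_1[z\wedge x_1]=t_2[z\wedge x_2]$. SwBvr$_\infty$: if $\mathsf{Dest}\,s=\mathsf L\,K$ and $\{(x,t),(x',t')\}\subseteq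 K$ then ($x'=x$ or $x'\,\#\,t$) and $t'=t[x'\wedge x]$. SwBvr$_{\infty,2}$: same as SwBvr$_\infty$ but with $x'\notin\mathsf{FV}\,t$ instead of $x'\,\#\,t$. Permutation: PmVr$_\infty$: if $\mathsf{Dest}\,t=\mathsf V\,x$ then $\mathsf{Dest}(t[\sigma])=\mathsf V(x[\sigma])$. PmAp$_\infty$: if $\mathsf{Dest}\,t=\mathsf A(t_1,t_2)$ then $\mathsf{Dest}(t[\sigma])=\mathsf A(t_1[\sigma],t_2[\sigma])$. PmLm$_\infty$: if $\mathsf{Dest}\,t=\mathsf L\,K$ then there is $K'$ with $\mathsf{Dest}(t[\sigma])=\mathsf L\,K'$ and $(x[\sigma],t'[\sigma])\in K'$ for all $(x,t')\in K$. PmId: $t[\mathsf{id}]=t$. PmCp: $t[\sigma][\tau]=t[\tau\circ\sigma]$. PmFv: if $\mathsf{supp}\,\sigma\cap\mathsf{FV}\,t=\emptyset$ then $t[\sigma]=t$. PmBvr$_\infty$: if $\mathsf{Dest}\,s=\mathsf L\,K$ and $\{(x,t),(x',t')\}\subseteq K$ then ($x'=x$ or $x'\notin\mathsf{FV}\,t$) and $t'=t[x'\leftrightarrow x]$. Substitution: SbVr$_\infty$: if $\mathsf{Dest}\,t=\mathsf V\,x$ then $\mathsf{Dest}(t[s/z])=$ (if $x=z$ then $\mathsf{Dest}\,s$ else $\mathsf V\,x$). SbAp$_\infty$: if $\mathsf{Dest}\,t=\mathsf A(t_1,t_2)$ then $\mathsf{Dest}(t[s/z])=\mathsf A(t_1[s/z],t_2[s/z])$.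 SbLm$_\infty$: if $\mathsf{Dest}\,t=\mathsf L\,K$ then there is $K'$ with $\mathsf{Dest}(t[s/z])=\mathsf L\,K'$ and $(x,t'[s/z])\in K'$ for all $(x,t')\in K$ with $x\neq z$ and $x\,\#\,s$. SbId: $t[(\mathsf{Vr}\,z)/z]=t$. SbChFr: if $x_2\,\#\,t$ then $t[(\mathsf{Vr}\,x_2)/x_1][s/x_2]=t[s/x_1]$. SbCm: if $x\neq y$, $y\,\#\,s$ and $x\,\#\,u$ then $t[s/x][u/y]=t[u/y][s/x]$. SbFr: if $y\,\#\,t$ then $t[s/y]=t$. FrSb: $z\,\#\,t[s/y]$ iff ($z=y$ or $z\,\#\,t$) and ($y\,\#\,t$ or $z\,\#\,s$). SbBvr$_\infty$: if $\mathsf{Dest}\,s=\mathsf L\,K$ and $\{(x,t),(x',t')\}\subseteq K$ then ($x'=x$ or $x'\,\#\,t$) and $t'=t[(\mathsf{Vr}\,x')/x]$. SbBvr$'_\infty$: if $\mathsf{Dest}\,s=\mathsf L\,K$, $(x,t)\in K$ and $x'\,\#\,t$ then $(x',t[(\mathsf{Vr}\,x')/x])\in K$. VrInv: $\mathsf{Dest}\,t=\mathsf V\,x$ iff $t=\mathsf{Vr}\,x$. FrVr: if $z\neq x$ then $z\,\#\,\mathsf{Vr}\,x$. Renaming: RnVr$_\infty$: if $\mathsf{Dest}\,t=\mathsf V\,x$ then $\mathsf{Dest}(t[y/z])=\mathsf V(x[y/z])$. RnAp$_\infty$: if $\mathsf{Dest}\,t=\mathsf A(t_1,t_2)$ then $\mathsf{Dest}(t[y/z])=\mathsf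 A(t_1[y/z],t_2[y/z])$. RnLm$_{1,\infty}$: if $\mathsf{Dest}\,t=\mathsf L\,K$ then there is $K'$ with $\mathsf{Dest}(t[y/z])=\mathsf L\,K'$ and $(x,t'[y/z])\in K'$ for all $(x,t')\in K$ with $x\notin\{y,z\}$. RnId: $t[z/z]=t$. RnIm: if $x_1\neq y$ then $t[x_1/y][x_2/y]=t[x_1/y]$. RnCh: if $y\neq x_2$ then $t[y/x_2][x_2/x_1][x_3/x_2]=t[y/x_2][x_3/x_1]$. RnCm: if $x_2\neq y_1\neq x_1\neq y_2$ then $t[x_2/x_1][y_2/y_1]=t[y_2/y_1][x_2/x_1]$. RnChFr: if $x_2\,\#\,t$ then $t[x_2/x_1][x_3/x_2]=t[x_3/x_1]$. RnFr: if $y\,\#\,t$ then $t[x/y]=t$. FrRn: $z\,\#\,t[x/y]$ iff ($z=y$ or $z\,\#\,t$) and ($y\,\#\,t$ or $x\neq z$). FrRn$_2$: $z[x/y]\,\#\,t[x/y]$ implies $z\,\#\,t$. RnBvr$_\infty$: if $\mathsf{Dest}\,s=\mathsf L\,K$ and $\{(x,t),(x',t')\}\subseteq K$ then ($x'=x$ or $x'\,\#\,t$) and $t'=t[x'/x]$. RnBvr$'_\infty$: if $\mathsf{Dest}\,s=\mathsf L\,K$, $(x,t)\in K$ and $x'\,\#\,t$ then $(x',t[x'/x])\in K$. Freshness/freeness: FrVr$_\infty$: if $\mathsf{Dest}\,t=\mathsf V\,x$ and $z\,\#\,t$ then $z\neq x$. FrAp$_\infty$: if $\mathsf{Dest}\,t=\mathsf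 A(t_1,t_2)$ and $z\,\#\,t$ then $z\,\#\,t_1$ and $z\,\#\,t_2$. FrLm$_\infty$: if $\mathsf{Dest}\,t=\mathsf L\,K$, $(x,t')\in K$ and $z\,\#\,t$ then $z=x$ or $z\,\#\,t'$. FvVr$_\infty$: if $\mathsf{Dest}\,t=\mathsf V\,x$ then $x\in\mathsf{FV}\,t$. FvAp$_\infty$: if $\mathsf{Dest}\,t=\mathsf A(t_1,t_2)$ then $\mathsf{FV}\,t_1\cup\mathsf{FV}\,t_2\subseteq\mathsf{FV}\,t$. FvLm$_\infty$: if $\mathsf{Dest}\,t=\mathsf L\,K$ and $(x,t')\in K$ then $\mathsf{FV}\,t'\setminus\{x\}\subseteq\mathsf{FV}\,t$. FvDPm$_\infty$: $\mathsf{FV}\,t=\{x\mid\{y\mid t[x\leftrightarrow y]\neq t\}\text{ is uncountable}\}$. FvDSw$_\infty$: $\mathsf{FV}\,t=\{x\mid\{y\mid t[x\wedge y]\neq t\}\text{ is uncountable}\}$. FSupFr$_\infty$: $\{x\mid\neg\,x\,\#\,t\}$ is countable. FrDRn$_\infty$: $x\,\#\,t$ iff $\{y\mid t[y/x]\neq t\}$ is countable. A $(\Sigma,\mathsf{Props})$-model is a $\Sigma$-model satisfying all properties in $\mathsf{Props}$. **The sets $\mathsf{Props}_i$.** $\mathsf{Props}_1$ (perm/free): PmVr$_\infty$, PmAp$_\infty$, PmLm$_\infty$, PmId, PmCp, FvDPm$_\infty$, PmBvr$_\infty$. $\mathsf{Props}_2$ (perm/free variant): PmVr$_\infty$, PmAp$_\infty$,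 PmLm$_\infty$, PmId, PmCp, PmFv, PmBvr$_\infty$, FvVr$_\infty$, FvAp$_\infty$, FvLm$_\infty$. $\mathsf{Props}_3$ (swap/free variant): SwVr$_\infty$, SwAp$_\infty$, SwLm$_\infty$, SwId, SwIv, SwCp, FvDSw$_\infty$, SwBvr$_{\infty,2}$. $\mathsf{Props}_5$ (swap/fresh variant): SwVr$_\infty$, SwAp$_\infty$, SwLm$_\infty$, SwId, SwIv, SwCp, SwFr, SwBvr$_\infty$, FrVr$_\infty$, FrAp$_\infty$, FrLm$_\infty$. $\mathsf{Props}_6$ (swap/fresh): SwVr$_\infty$, SwAp$_\infty$, SwLm$_\infty$, SwId, SwIv, SwCp, SwFr, FrSw, SwCg$_\infty$, FrVr$_\infty$, FrAp$_\infty$, FrLm$_\infty$. $\mathsf{Props}_7$ (subst/fresh): SbVr$_\infty$, SbAp$_\infty$, SbLm$_\infty$, SbId, SbChFr, SbCm, SbFr, FrSb, SbBvr$_\infty$, SbBvr$'_\infty$, FSupFr$_\infty$, FrVr$_\infty$, FrAp$_\infty$, FrLm$_\infty$, VrInv, FrVr. $\mathsf{Props}_8$ (renaming): RnVr$_\infty$, RnAp$_\infty$, RnLm$_{1,\infty}$, RnId, RnIm, RnCh, RnCm, FrDRn$_\infty$, RnBvr$_\infty$, RnBvr$'_\infty$, FSupFr$_\infty$, FrRn$_2$. $\mathsf{Props}_9$ (renaming/fresh variant): RnVr$_\infty$, RnAp$_\infty$, RnLm$_{1,\infty}$, RnId, RnChFr, RnCm, RnFr, FrRn, RnBvr$_\infty$,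 RnBvr$'_\infty$, FSupFr$_\infty$, FrVr$_\infty$, FrAp$_\infty$, FrLm$_\infty$. *)

(* Defs.v *)
From HB Require Import structures.
From mathcomp Require Import all_boot.
From mathcomp Require Import boolp classical_sets functions cardinality.

Set Implicit Arguments.
Unset Strict Implicit.
Unset Printing Implicit Defensive.

Local Open Scope classical_set_scope.
Local Open Scope card_scope.
Local Open Scope quotient_scope.

(* [aleph_1] is the least uncountable cardinal: [T] is uncountable and has no
   uncountable subset of smaller cardinality. *)
Definition card_aleph1 (T : Type) : Prop :=
  ~ countable [set: T] /\
  forall A : set T, ~ countable A -> A #= [set: T].

Record varType := VarType {
  var_eqType :> eqType;
  var_aleph1 : card_aleph1 var_eqType
}.

Definition transp (X : eqType) (z1 z2 x : X) : X :=
  if x == z1 then z2 else if x == z2 then z1 else x.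

Definition var_ren (X : eqType) (y z x : X) : X := if x == z then y else x.

Section Transp.
Variable X : eqType.
Implicit Types x y z : X.

Lemma transpL x y : transp x y x = y. Proof. by rewrite /transp eqxx. Qed.

Lemma transpR x y : transp x y y = x.
Proof. by rewrite /transp eqxx; case: eqP. Qed.

Lemma transpD x y z : z <> x -> z <> y -> transp x y z = z.
Proof. by rewrite /transp; case: eqP => //; case: eqP. Qed.

Lemma transpK x y : involutive (transp x y).
Proof.
move=> z; case: (pselect (z = x)) => [->|nx]; first by rewrite transpL transpR.
case: (pselect (z = y)) => [->|ny]; first by rewrite transpR transpL.
by rewrite !transpD.
Qed.

Lemma transp_inj x y : injective (transp x y).
Proof. exact: inv_inj (@transpK x y). Qed.

Lemma transp_fin x y : finite_set [set z | transp x y z != z].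
Proof.
apply: (@sub_finite_set _ _ [set x; y]); last exact: finite_set2.
move=> z /= /eqP nz; case: (pselect (z = x)) => [|nx]; first by left.
by case: (pselect (z = y)) => [|ny]; [right|rewrite transpD in nz].
Qed.

End Transp.

Record finperm (X : eqType) := FinPerm {
  perm_fun :> X -> X;
  perm_bij : bijective perm_fun;
  perm_fin : finite_set [set x | perm_fun x != x]
}.

Definition supp (X : eqType) (s : finperm X) : set X := [set x | s x != x].

Section FinPerm.
Variable X : eqType.

Lemma id_fin : finite_set [set x : X | id x != x].
Proof.
by rewrite (_ : mkset _ = set0) // -subset0 => x /=; rewrite eqxx.
Qed.

Lemma comp_fin (t s : finperm X) : finite_set [set x | (t \o s) x != x].
Proof.
apply: (@sub_finite_set _ _ (supp s `|` supp t)).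
  move=> x /= h; case: (pselect (s x = x)) => [e|/eqP]; last by left.
  by right; move: h; rewrite /supp /= e.
by rewrite finite_setU; split; exact: perm_fin.
Qed.

Definition perm_id : finperm X := FinPerm (Bijective (frefl id) (frefl id)) id_fin.

Definition perm_comp (t s : finperm X) : finperm X :=
  FinPerm (bij_comp (perm_bij t) (perm_bij s)) (comp_fin t s).

Definition perm_transp (x y : X) : finperm X :=
  FinPerm (inv_bij (@transpK X x y)) (transp_fin x y).

End FinPerm.

(* The equality of [preiterm] is finer than bisimilarity, so [preiterm] is a
   final coalgebra only up to bisimilarity; since bisimilar pre-iterms are
   alpha-equivalent (lemma [bisim_alpha]), this does not affect the quotient. *)
CoInductive preiterm (Var : Type) : Type :=
  | PVr (x : Var)
  | PAp (p1 p2 : preiterm Var)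
  | PLm (x : Var) (p : preiterm Var).

HB.instance Definition _ (Var : Type) := gen_eqMixin (preiterm Var).
HB.instance Definition _ (Var : Type) := gen_choiceMixin (preiterm Var).

CoFixpoint premap (Var : Type) (f : Var -> Var) (p : preiterm Var) :
    preiterm Var :=
  match p with
  | PVr x => PVr (f x)
  | PAp p1 p2 => PAp (premap f p1) (premap f p2)
  | PLm x p' => PLm (f x) (premap f p')
  end.

Definition pswap (Var : eqType) (p : preiterm Var) (z1 z2 : Var) :=
  premap (transp z1 z2) p.

Definition pperm (Var : eqType) (p : preiterm Var) (s : finperm Var) :=
  premap s p.

CoInductive pfresh (Var : Type) (z : Var) : preiterm Var -> Prop :=
  | pfresh_Vr x : z <> x -> pfresh z (PVr x)
  | pfresh_Ap p1 p2 : pfresh z p1 -> pfresh z p2 -> pfresh z (PAp p1 p2)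
  | pfresh_Lm x p : z = x \/ pfresh z p -> pfresh z (PLm x p).

CoInductive alpha (Var : eqType) : preiterm Var -> preiterm Var -> Prop :=
  | alpha_Vr x : alpha (PVr x) (PVr x)
  | alpha_Ap p1 p2 q1 q2 : alpha p1 q1 -> alpha p2 q2 ->
      alpha (PAp p1 p2) (PAp q1 q2)
  | alpha_Lm x y z p q : z = x \/ pfresh z p -> z = y \/ pfresh z q ->
      alpha (pswap p z x) (pswap q z y) -> alpha (PLm x p) (PLm y q).

CoInductive bisim (Var : Type) : preiterm Var -> preiterm Var -> Prop :=
  | bisim_Vr x : bisim (PVr x) (PVr x)
  | bisim_Ap p1 p2 q1 q2 : bisim p1 q1 -> bisim p2 q2 ->
      bisim (PAp p1 p2) (PAp q1 q2)
  | bisim_Lm x p q : bisim p q -> bisim (PLm x p) (PLm x q).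

Section Preiterm.
Variable Var : eqType.
Implicit Types (x y z : Var) (p q r : preiterm Var) (f g : Var -> Var).

Lemma premap_unfold f p : premap f p =
  match p with
  | PVr x => PVr (f x)
  | PAp p1 p2 => PAp (premap f p1) (premap f p2)
  | PLm x p' => PLm (f x) (premap f p')
  end.
Proof.
rewrite -[LHS](_ : match premap f p with
  | PVr x => PVr x | PAp a b => PAp a b | PLm x a => PLm x a end = premap f p).
  by case: p.
by case: (premap f p).
Qed.

Lemma premapVr f x : premap f (PVr x) = PVr (f x).
Proof. by rewrite premap_unfold. Qed.
Lemma premapAp f p q : premap f (PAp p q) = PAp (premap f p) (premap f q).
Proof. by rewrite premap_unfold. Qed.
Lemma premapLm f x p : premap f (PLm x p) = PLm (f x) (premap f p).
Proof. by rewrite premap_unfold. Qed.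
Definition premapE := (premapVr, premapAp, premapLm).

Lemma bisim_refl p : bisim p p.
Proof. by move: p; cofix CH; case=> *; constructor. Qed.

Lemma bisim_sym p q : bisim p q -> bisim q p.
Proof. by move: p q; cofix CH => p q [] *; constructor; apply: CH. Qed.

Lemma bisim_trans q p r : bisim p q -> bisim q r -> bisim p r.
Proof.
move: p q r; cofix CH => p q r [x|p1 p2 q1 q2 h1 h2|x p' q' h] h'; inversion h'; subst.
- by constructor.
- by constructor; [apply: (CH _ q1)|apply: (CH _ q2)].
- by constructor; apply: (CH _ q').
Qed.

Lemma bisim_map f p q : bisim p q -> bisim (premap f p) (premap f q).
Proof.
move: p q; cofix CH => p q [x|p1 p2 q1 q2 h1 h2|x p' q' h]; rewrite !premapE;
  by constructor; apply: CH.
Qed.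

Lemma bisim_ext f g p : f =1 g -> bisim (premap f p) (premap g p).
Proof.
move=> fg; move: p; cofix CH => -[x|p q|x p]; rewrite !premapE ?fg;
  by constructor; apply: CH.
Qed.

Lemma bisim_id p : bisim (premap id p) p.
Proof.
by move: p; cofix CH => -[x|p q|x p]; rewrite !premapE; constructor; apply: CH.
Qed.

Lemma bisim_comp f g p : bisim (premap f (premap g p)) (premap (f \o g) p).
Proof.
by move: p; cofix CH => -[x|p q|x p]; rewrite !premapE; constructor; apply: CH.
Qed.

Lemma bisim_fresh z p q : bisim p q -> pfresh z p -> pfresh z q.
Proof.
move: p q; cofix CH => p q [x|p1 p2 q1 q2 h1 h2|x p' q' h] h'; inversion h'; subst.
- by constructor.
- by constructor; [apply: (CH p1)|apply: (CH p2)].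
- constructor; case: H0 => [->|H0]; [by left|right; exact: (CH p')].
Qed.

Lemma fresh_map f z p : injective f -> pfresh z p -> pfresh (f z) (premap f p).
Proof.
move=> fi; move: p; cofix CH => p [x ne|p1 p2 h1 h2|x p' h]; rewrite premapE.
- by constructor=> /fi.
- by constructor; apply: CH.
- constructor; case: h => [->|h]; [by left|right; exact: CH].
Qed.

Lemma fresh_unmap f z p :
  injective f -> pfresh (f z) (premap f p) -> pfresh z p.
Proof.
move=> fi; move: p; cofix CH => -[x|p q|x p]; rewrite premapE => h; inversion h; subst.
- by constructor=> e; apply: H0; rewrite e.
- by constructor; apply: CH.
- by constructor; case: H0 => [/fi ->|h0]; [left|right; exact: CH].
Qed.

Fixpoint occ (l : seq bool) p : option Var :=
  match l, p with
  | _, PVr x => Some x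
  | b :: l', PAp p1 p2 => if b then occ l' p1 else occ l' p2
  | _ :: l', PLm x p' => occ l' p'
  | _, _ => None
  end.

Lemma occ_fresh z p : (forall l, occ l p <> Some z) -> pfresh z p.
Proof.
move: p; cofix CH => -[x|p q|x p] h.
- by constructor=> e; apply: (h [::]); rewrite e.
- by constructor; apply: CH => l; [apply: (h (true :: l))|apply: (h (false :: l))].
- by constructor; right; apply: CH => l; apply: (h (true :: l)).
Qed.

Lemma countable_FV p : countable [set z | ~ pfresh z p].
Proof.
rewrite -(eq_countable card_some).
apply: (@sub_countable _ _ _ (occ^~ p @` [set: seq bool])).
  apply: subset_card_le => o [z /= nz <-]; apply: contrapT => hn.
  by apply: nz; apply: occ_fresh => l e; apply: hn; exists l.
by apply: sub_countable (card_image_le _ _) _; exact: countableP.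
Qed.

Variant alpha_step (R : preiterm Var -> preiterm Var -> Prop) :
    preiterm Var -> preiterm Var -> Prop :=
  | step_Vr x : alpha_step R (PVr x) (PVr x)
  | step_Ap p1 p2 q1 q2 : R p1 q1 -> R p2 q2 ->
      alpha_step R (PAp p1 p2) (PAp q1 q2)
  | step_Lm x y z p q : z = x \/ pfresh z p -> z = y \/ pfresh z q ->
      R (pswap p z x) (pswap q z y) -> alpha_step R (PLm x p) (PLm y q).

Lemma alpha_coind (R : preiterm Var -> preiterm Var -> Prop) :
  (forall p q, R p q -> alpha_step R p q) -> forall p q, R p q -> alpha p q.
Proof.
move=> hR; cofix CH => p q /hR [x|p1 p2 q1 q2 h1 h2|x y z p' q' hz1 hz2 h].
- by constructor.
- by constructor; apply: CH.
- by apply: (@alpha_Lm _ x y z) => //; apply: CH.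
Qed.

Lemma alpha_unfold p q : alpha p q -> alpha_step (@alpha Var) p q.
Proof. by case=> *; econstructor; eassumption. Qed.

Lemma transp_id x : transp x x =1 id.
Proof. by move=> y; rewrite /transp; case: eqP. Qed.

Lemma bisim_alpha p q : bisim p q -> alpha p q.
Proof.
apply: (@alpha_coind (@bisim Var)) => {}p {}q [x|p1 p2 q1 q2 h1 h2|x p' q' h].
- by constructor.
- by constructor.
- apply: (@step_Lm _ x x x); [by left|by left|exact: bisim_map].
Qed.

Lemma alpha_refl p : alpha p p.
Proof. exact/bisim_alpha/bisim_refl. Qed.

Lemma alpha_sym p q : alpha p q -> alpha q p.
Proof.
apply: (@alpha_coind (fun p q => alpha q p)) => {}p {}q /alpha_unfold
  [x|p1 p2 q1 q2 h1 h2|x y z p' q' hz1 hz2 h]; econstructor; eassumption.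
Qed.

Lemma transp_map f x y : injective f ->
  transp (f x) (f y) \o f =1 f \o transp x y.
Proof.
move=> fi u /=; case: (pselect (u = x)) => [->|nx]; first by rewrite !transpL.
case: (pselect (u = y)) => [->|ny]; first by rewrite !transpR.
by rewrite !transpD // => /fi.
Qed.

Lemma bisim_swap_map f z x p : injective f ->
  bisim (pswap (premap f p) (f z) (f x)) (premap f (pswap p z x)).
Proof.
move=> fi; apply: bisim_trans (bisim_comp _ _ _) _.
apply: bisim_trans (bisim_ext _ (transp_map _ _ fi)) _.
exact/bisim_sym/bisim_comp.
Qed.

Lemma alpha_map f p q : injective f ->
  alpha p q -> alpha (premap f p) (premap f q).
Proof.
move=> fi pq; pose R a b := exists p q,
  [/\ alpha p q, bisim a (premap f p) & bisim b (premap f q)].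
apply: (@alpha_coind R); last by exists p, q; split=> //; exact: bisim_refl.
move=> {pq p q} a b [p [q [/alpha_unfold pq ha hb]]].
case: pq ha hb => [x|p1 p2 q1 q2 h1 h2|x y z p' q' hz1 hz2 h];
  rewrite !premapE => ha hb; inversion ha; inversion hb; subst.
- by constructor.
- by constructor; [exists p1, q1|exists p2, q2].
- have fr u (r r0 : preiterm Var) : bisim r0 (premap f r) ->
      z = u \/ pfresh z r -> f z = f u \/ pfresh (f z) r0.
    move=> h0 [->|h1]; [by left|right].
    by apply: bisim_fresh (bisim_sym h0) _; exact: fresh_map.
  apply: (@step_Lm _ _ _ (f z)); [exact: (fr _ p')|exact: (fr _ q')|].
  exists (pswap p' z x), (pswap q' z y); split=> //.
    by apply: bisim_trans (bisim_map _ _) (bisim_swap_map _ _ _ fi).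
  by apply: bisim_trans (bisim_map _ _) (bisim_swap_map _ _ _ fi).
Qed.

End Preiterm.

Section Alpha.
Variable Var : varType.
Implicit Types (x y z : Var) (p q r : preiterm Var) (f g : Var -> Var).

Lemma countable_U (A B : set Var) : countable A -> countable B -> countable (A `|` B).
Proof.
move=> cA cB; rewrite -bigcup2E; apply: bigcup_countable => //.
by move=> [|[|n]] _ /=; [| |exact: countable0].
Qed.

Lemma ex_notin (A : set Var) : countable A -> exists x, ~ A x.
Proof.
move=> cA; apply: contrapT => /forallNP h; apply: (var_aleph1 Var).1.
apply: sub_countable cA; apply: subset_card_le => x _; exact: contrapT (h x).
Qed.

Fixpoint freshs z (s : seq (preiterm Var)) : Prop :=
  if s is p :: s' then pfresh z p /\ freshs z s' else True.

Lemma ex_fresh (s : seq (preiterm Var)) : exists z, freshs z s.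
Proof.
suff /ex_notin[z /contrapT] : countable [set z | ~ freshs z s] by exists z.
elim: s => [|p s IH] /=.
  by rewrite (_ : mkset _ = set0) ?countable0 // -subset0 => x /= /(_ I).
apply: sub_countable (countable_U (countable_FV p) IH).
by apply: subset_card_le => z /= /not_andP.
Qed.

Lemma fresh_var z x : pfresh z (PVr x) -> z <> x.
Proof. by move=> h; inversion h. Qed.

(* Injective maps that agree on the free variables. *)
Lemma alpha_ext f g p : injective f -> injective g ->
  (forall x, ~ pfresh x p -> f x = g x) -> alpha (premap f p) (premap g p).
Proof.
move=> fi gi fg; pose R a b := exists p f g, [/\ injective f, injective g,
  forall x, ~ pfresh x p -> f x = g x, bisim a (premap f p) & bisim b (premap g p)].
apply: (@alpha_coind _ R); last by exists p, f, g; split=> //; exact: bisim_refl.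
move=> {fi gi fg p f g} a b [p [f [g [fi gi fg]]]].
case: p fg => [x|p1 p2|x p] fg; rewrite !premapE => ha hb;
  inversion ha; inversion hb; subst.
- rewrite fg; first by constructor.
  by move=> /fresh_var.
- constructor; [exists p1, f, g|exists p2, f, g]; split=> // x nx; apply: fg => h;
    by inversion h.
- match goal with H1 : bisim ?a0 (premap f p), H2 : bisim ?b0 (premap g p) |- _ =>
    rename a0 into a, b0 into b end.
  have [z /= [za [zb [zfp [zgp _]]]]] := ex_fresh [:: a; b; premap f p; premap g p].
  apply: (@step_Lm _ _ _ _ z); [by right|by right|].
  exists p, (transp z (f x) \o f), (transp z (g x) \o g); split.
  + exact: inj_comp (@transp_inj _ _ _) fi.
  + exact: inj_comp (@transp_inj _ _ _) gi.
  + move=> y ny /=; case: (pselect (y = x)) => [->|yx]; first by rewrite !transpR.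
    have fgy : f y = g y by apply: fg => h; inversion h; case: H0.
    have zy : f y <> z by move=> e; apply: ny; apply: (@fresh_unmap _ f); rewrite // e.
    rewrite !transpD // -?fgy //; last by move=> /fi.
    by rewrite fgy => /gi.
  + by apply: bisim_trans (bisim_map _ _) (bisim_comp _ _ _).
  + by apply: bisim_trans (bisim_map _ _) (bisim_comp _ _ _).
Qed.

Inductive chain : preiterm Var -> preiterm Var -> Prop :=
  | chain1 p q : alpha p q -> chain p q
  | chainT p q r : chain p q -> chain q r -> chain p r.

Lemma chain_map f p q : injective f -> chain p q -> chain (premap f p) (premap f q).
Proof.
move=> fi; elim=> {p q} [p q h|p q r _ IH1 _ IH2].
  by apply: chain1; exact: alpha_map.
exact: chainT IH1 IH2.
Qed.

Lemma rebind_agree z0 z x p : z = x \/ pfresh z p -> pfresh z0 p ->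
  forall y, ~ pfresh y p -> transp z0 x y = (transp z0 z \o transp z x) y.
Proof.
move=> hz h0 y ny /=; case: (pselect (y = x)) => [->|yx]; first by rewrite !transpR.
have y0 : y <> z0 by move=> e; apply: ny; rewrite e.
have yz : y <> z by move=> e; case: hz => [zx|]; [apply: yx; rewrite e|rewrite -e].
by rewrite !transpD.
Qed.

Lemma chain_rebind z0 z x p : z = x \/ pfresh z p -> pfresh z0 p ->
  chain (pswap p z0 x) (pswap (pswap p z x) z0 z).
Proof.
move=> hz h0; apply: (@chainT _ (premap (transp z0 z \o transp z x) p)).
  apply/chain1/alpha_ext; [exact: transp_inj| |exact: rebind_agree].
  exact: inj_comp (@transp_inj _ _ _) (@transp_inj _ _ _).
exact/chain1/bisim_alpha/bisim_sym/bisim_comp.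
Qed.

Lemma chain_sym p q : chain p q -> chain q p.
Proof.
elim=> {p q} [p q /alpha_sym h|p q r _ h1 _ h2]; [exact: chain1|exact: chainT h2 h1].
Qed.

Lemma chain_step p q : chain p q -> alpha_step chain p q.
Proof.
elim=> {p q} [p q /alpha_unfold[x|p1 p2 q1 q2 h1 h2|x y z p' q' hz1 hz2 h]|p q r _ + _ +].
- by constructor.
- by constructor; exact: chain1.
- by apply: (@step_Lm _ _ _ _ z) => //; exact: chain1.
case=> [x|p1 p2 q1 q2 h1 h2|x y z p' q' hz1 hz2 h] h'; inversion h' as
  [|? ? r1 r2 k1 k2|? w v ? r' kv1 kv2 k]; subst.
- by constructor.
- by constructor; [exact: chainT h1 k1|exact: chainT h2 k2].
- have [z0 /= [f1 [f2 [f3 _]]]] := ex_fresh [:: p'; q'; r'].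
  apply: (@step_Lm _ _ _ _ z0); [by right|by right|].
  apply: chainT (chain_rebind hz1 f1) _.
  apply: chainT (chain_map (@transp_inj _ _ _) h) _.
  apply: chainT (chain_sym (chain_rebind hz2 f2)) _.
  apply: chainT (chain_rebind kv1 f2) _.
  apply: chainT (chain_map (@transp_inj _ _ _) k) _.
  exact: chain_sym (chain_rebind kv2 f3).
Qed.

Lemma alpha_trans q p r : alpha p q -> alpha q r -> alpha p r.
Proof.
move=> h1 h2; apply: (@alpha_coind _ chain) => [|]; first exact: chain_step.
by apply: chainT (chain1 h1) (chain1 h2).
Qed.

Lemma chain_alpha p q : chain p q -> alpha p q.
Proof. by elim=> {p q} // p q r _ h1 _ h2; exact: alpha_trans h1 h2. Qed.

Lemma alpha_rebind z0 z x p : z = x \/ pfresh z p -> pfresh z0 p ->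
  alpha (pswap p z0 x) (pswap (pswap p z x) z0 z).
Proof. by move=> h1 h2; apply/chain_alpha/chain_rebind. Qed.

(* The binder case of [alpha] holds for every fresh variable. *)
Lemma alpha_Lm_inv z0 x y p q : alpha (PLm x p) (PLm y q) ->
  pfresh z0 p -> pfresh z0 q -> alpha (pswap p z0 x) (pswap q z0 y).
Proof.
move=> /alpha_unfold h; inversion h as [| |? ? z ? ? hz1 hz2 k] => f1 f2; subst.
apply: alpha_trans (alpha_rebind hz1 f1) _.
apply: alpha_trans (alpha_map (@transp_inj _ _ _) k) _.
exact: alpha_sym (alpha_rebind hz2 f2).
Qed.

Lemma alpha_Ap_inv p1 p2 q1 q2 :
  alpha (PAp p1 p2) (PAp q1 q2) -> alpha p1 q1 /\ alpha p2 q2.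
Proof. by move=> h; inversion h. Qed.

Lemma alpha_swapid p x : alpha (pswap p x x) p.
Proof.
apply/bisim_alpha/(bisim_trans _ (bisim_id p))/bisim_ext; exact: transp_id.
Qed.

Lemma alpha_Lm_congr x p q : alpha p q -> alpha (PLm x p) (PLm x q).
Proof.
move=> h; apply: (@alpha_Lm _ x x x); [by left|by left|].
apply: alpha_trans (alpha_swapid _ _) _; apply: alpha_trans h _.
exact/alpha_sym/alpha_swapid.
Qed.

Lemma alpha_swapK p x y : alpha (pswap (pswap p x y) x y) p.
Proof.
apply/bisim_alpha/(bisim_trans (bisim_comp _ _ _))/(bisim_trans _ (bisim_id p)).
by apply/bisim_ext => z /=; exact: transpK.
Qed.

Lemma fresh_swap z x y p : z <> x -> z <> y -> pfresh z p -> pfresh z (pswap p x y).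
Proof.
move=> zx zy h; rewrite -[z](@transpD _ x y) //.
by apply: fresh_map h; exact: transp_inj.
Qed.

Lemma alpha_fresh z p q : alpha p q -> pfresh z p -> pfresh z q.
Proof.
move=> h1 h2; have : exists2 p, alpha p q & pfresh z p by exists p.
move: q {p h1 h2}; cofix CH => q [p] /alpha_unfold
  [x|p1 p2 q1 q2 h1 h2|x y z' p' q' hz1 hz2 h] h'; inversion h' as [|? ? k1 k2|? ? k]; subst.
- by constructor.
- by constructor; apply: CH; [exists p1|exists p2].
- constructor; case: (pselect (z = y)) => [|zy]; [by left|right].
  case: (pselect (z = z')) hz2 => [<- [//|//]|zz' _].
  apply: CH; exists (pswap (pswap p' z' x) z' y).
    by apply: alpha_trans (alpha_map (@transp_inj _ _ _) h) (alpha_swapK _ _ _).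
  apply: fresh_swap => //; case: (pselect (z = x)) => [zx|zx].
    case: hz1 => [e|hz1]; first by rewrite zx e in zz'.
    by have := fresh_map (@transp_inj _ z' x) hz1; rewrite transpL zx.
  by apply: fresh_swap => //; case: k.
Qed.


Definition alphab p q : bool := `[< alpha p q >].

Lemma alphab_refl : reflexive alphab.
Proof. by move=> p; apply/asboolP; exact: alpha_refl. Qed.

Lemma alphab_sym : symmetric alphab.
Proof. by move=> p q; apply: asbool_equiv_eq; split=> /alpha_sym. Qed.

Lemma alphab_trans : transitive alphab.
Proof.
by move=> q p r /asboolP pq /asboolP qr; apply/asboolP; exact: alpha_trans pq qr.
Qed.

Canonical alpha_equiv := EquivRel alphab alphab_refl alphab_sym alphab_trans.

End Alpha.

Definition iterm (Var : varType) : Type := {eq_quot (@alpha_equiv Var)}.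

Section Iterm.
Variable Var : varType.
Notation Tr := (iterm Var).
Implicit Types (x y z : Var) (t s u : Tr) (p q : preiterm Var).

Lemma iterm_eqP p q : \pi_Tr p = \pi_Tr q <-> alpha p q.
Proof. by split=> [/eqmodP/asboolP|h] //; apply/eqmodP/asboolP. Qed.

Lemma repr_pi p : alpha (repr (\pi_Tr p)) p.
Proof. by apply/iterm_eqP; rewrite reprK. Qed.

Definition Vr x : Tr := \pi_Tr (PVr x).
Definition Ap t1 t2 : Tr := \pi_Tr (PAp (repr t1) (repr t2)).
Definition Lm x t : Tr := \pi_Tr (PLm x (repr t)).
Definition swap t z1 z2 : Tr := \pi_Tr (pswap (repr t) z1 z2).
Definition perm t (s : finperm Var) : Tr := \pi_Tr (pperm (repr t) s).
Definition fresh z t : Prop := pfresh z (repr t).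
Definition FV t : set Var := [set x | ~ fresh x t].

Lemma pi_Ap p q : \pi_Tr (PAp p q) = Ap (\pi_Tr p) (\pi_Tr q).
Proof. by apply/iterm_eqP/alpha_Ap; exact/alpha_sym/repr_pi. Qed.

Lemma pi_Lm x p : \pi_Tr (PLm x p) = Lm x (\pi_Tr p).
Proof. by apply/iterm_eqP/alpha_Lm_congr/alpha_sym/repr_pi. Qed.

Lemma pi_swap p z1 z2 : \pi_Tr (pswap p z1 z2) = swap (\pi_Tr p) z1 z2.
Proof.
by apply/iterm_eqP/alpha_map/alpha_sym/repr_pi; exact: transp_inj.
Qed.

Lemma pi_perm p (s : finperm Var) : \pi_Tr (pperm p s) = perm (\pi_Tr p) s.
Proof. by apply/iterm_eqP/alpha_map/alpha_sym/repr_pi/bij_inj/perm_bij. Qed.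

Lemma pi_fresh z p : fresh z (\pi_Tr p) <-> pfresh z p.
Proof. by split; apply: alpha_fresh; [|apply: alpha_sym]; exact: repr_pi. Qed.

End Iterm.

(* The functor [Var + M * M + P_ne (Var * M)]. *)
Inductive dtor (Var M : Type) : Type :=
  | InV (x : Var)
  | InA (m1 m2 : M)
  | InL (K : {K : set (Var * M) | K !=set0}).

Arguments InV {Var M} x.
Arguments InA {Var M} m1 m2.
Arguments InL {Var M} K.

Section Dest.
Variable Var : varType.
Notation Tr := (iterm Var).
Implicit Types (x y z : Var) (t s u : Tr) (p q : preiterm Var).

Definition Lm_views t : set (Var * Tr) := [set xt | t = Lm xt.1 xt.2].

Lemma Lm_views_neq0 t x p : repr t = PLm x p -> Lm_views t !=set0.
Proof.
by move=> e; exists (x, \pi_Tr p); rewrite /Lm_views /= -pi_Lm -e reprK.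
Qed.

Definition Dest t : dtor Var Tr :=
  match repr t as p return repr t = p -> dtor Var Tr with
  | PVr x => fun _ => InV x
  | PAp p1 p2 => fun _ => InA (\pi_Tr p1) (\pi_Tr p2)
  | PLm x p => fun e => InL (exist _ (Lm_views t) (Lm_views_neq0 e))
  end erefl.

Lemma DestE t :
  match repr t with
  | PVr x => Dest t = InV x
  | PAp p1 p2 => Dest t = InA (\pi_Tr p1) (\pi_Tr p2)
  | PLm x p => exists h, Dest t = InL (exist _ (Lm_views t) h)
  end.
Proof.
rewrite /Dest; move: (@Lm_views_neq0 t); case: (repr t) => // x p h.
by exists (h x p erefl).
Qed.

Lemma Dest_Vr x : Dest (Vr x) = InV x.
Proof.
have := alpha_unfold (repr_pi (PVr x)); move: (DestE (Vr x)).
rewrite -/(Vr x); case: (repr (Vr x)) => [y|p q|y p] e h; inversion h.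
by rewrite e; congr InV.
Qed.

Lemma Dest_Ap t1 t2 : Dest (Ap t1 t2) = InA t1 t2.
Proof.
have := alpha_unfold (repr_pi (PAp (repr t1) (repr t2))); move: (DestE (Ap t1 t2)).
rewrite -/(Ap t1 t2); case: (repr (Ap t1 t2)) => [y|p q|y p] e h; inversion h; subst.
by rewrite e; congr InA; rewrite -[RHS]reprK; apply/iterm_eqP.
Qed.

Lemma Dest_Lm x t : exists h, Dest (Lm x t) = InL (exist _ (Lm_views (Lm x t)) h).
Proof.
have := alpha_unfold (repr_pi (PLm x (repr t))); move: (DestE (Lm x t)).
by rewrite -/(Lm x t); case: (repr (Lm x t)) => [y|p q|y p] e h; inversion h.
Qed.

End Dest.

Section Subst.
Variable Var : varType.
Notation Tr := (iterm Var).

Definition is_subst (sb : Tr -> Tr -> Var -> Tr) : Prop :=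
  [/\ forall x s z, sb (Vr x) s z = if x == z then s else Vr x,
      forall t1 t2 s z, sb (Ap t1 t2) s z = Ap (sb t1 s z) (sb t2 s z) &
      forall x t s z, x <> z -> fresh x s -> sb (Lm x t) s z = Lm x (sb t s z)].

Implicit Types (x y z w : Var) (p q r s : preiterm Var) (f g h : Var -> Var).

Definition freshv (ps : seq (preiterm Var)) : Var := sval (cid (ex_fresh ps)).

Lemma freshvP ps : freshs (freshv ps) ps.
Proof. exact: svalP (cid (ex_fresh ps)). Qed.

CoFixpoint psub s z p : preiterm Var :=
  match p with
  | PVr x => if x == z then s else PVr x
  | PAp p1 p2 => PAp (psub s z p1) (psub s z p2)
  | PLm x p' => let w := freshv [:: p'; s; PVr z] in
      PLm w (psub s z (pswap p' w x))
  end.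

Lemma psub_unfold s z p : psub s z p =
  match p with
  | PVr x => if x == z then s else PVr x
  | PAp p1 p2 => PAp (psub s z p1) (psub s z p2)
  | PLm x p' => let w := freshv [:: p'; s; PVr z] in
      PLm w (psub s z (pswap p' w x))
  end.
Proof.
rewrite -[LHS](_ : match psub s z p with
  | PVr x => PVr x | PAp a b => PAp a b | PLm x a => PLm x a end = psub s z p).
  by case: p => //= x; case: (x == z) => //; case: s.
by case: (psub s z p).
Qed.

Lemma psub_alpha h1 h2 p q s1 s2 z1 z2 : injective h1 -> injective h2 ->
  alpha (premap h1 p) (premap h2 q) -> alpha (premap h1 s1) (premap h2 s2) ->
  h1 z1 = h2 z2 -> alpha (premap h1 (psub s1 z1 p)) (premap h2 (psub s2 z2 q)).
Proof.
pose R a b := alpha a b \/ exists h1 h2 p q s1 s2 z1 z2,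
  [/\ injective h1 /\ injective h2,
      alpha (premap h1 p) (premap h2 q) /\ alpha (premap h1 s1) (premap h2 s2),
      h1 z1 = h2 z2,
      bisim a (premap h1 (psub s1 z1 p)) &
      bisim b (premap h2 (psub s2 z2 q))].
move=> i1 i2 hp hs hz; apply: (@alpha_coind _ R); last first.
  right; exists h1, h2, p, q, s1, s2, z1, z2; split=> //; exact: bisim_refl.
have alpha_R a b : alpha a b -> alpha_step R a b.
  case/alpha_unfold => *; econstructor; try eassumption; by left.
move=> {h1 h2 p q s1 s2 z1 z2 i1 i2 hp hs hz} a b [/alpha_R //|].
move=> [h1 [h2 [p [q [s1 [s2 [z1 [z2 [[i1 i2] [hp hs] hz]]]]]]]]].
rewrite [psub s1 _ _]psub_unfold [psub s2 _ _]psub_unfold.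
case: p q hp => [x|p1 p2|x p] [y|q1 q2|y q] hp;
  have := hp; rewrite !premapE => /alpha_unfold hp'; inversion hp'.
- move=> ha hb; apply/alpha_R.
  apply: alpha_trans (bisim_alpha ha) (alpha_trans _ (alpha_sym (bisim_alpha hb))).
  case: eqP => [xz|xz]; case: eqP => [yz|yz] //.
  + by case: yz; apply: i2; rewrite -hz -xz.
  + by case: xz; apply: i1; rewrite hz -yz.
- move: hp; rewrite !premapE => /alpha_Ap_inv[k1 k2] ha hb.
  inversion ha; inversion hb; subst.
  by constructor; right; do 8 eexists; split; try eassumption; split; eassumption.
- move: (freshv _) (freshvP [:: p; s1; PVr z1]) => w1 /= [fp [fs1 [/fresh_var fz1 _]]].
  move: (freshv _) (freshvP [:: q; s2; PVr z2]) => w2 /= [fq [fs2 [/fresh_var fz2 _]]] ha hb.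
  inversion ha as [| |? a' ? ha']; inversion hb as [| |? b' ? hb']; subst.
  have [c /= [ga [gb [gp [gq [gs1 [gs2 [/fresh_var gz _]]]]]]]] := ex_fresh
    [:: a'; b'; premap h1 p; premap h2 q; premap h1 s1; premap h2 s2; PVr (h1 z1)].
  apply: (@step_Lm _ _ _ _ c); [by right|by right|right].
  exists (transp c (h1 w1) \o h1), (transp c (h2 w2) \o h2),
    (pswap p w1 x), (pswap q w2 y), s1, s2, z1, z2.
  have ti f w' : injective f -> injective (transp c (f w') \o f).
    by move=> i; apply: inj_comp i; exact: transp_inj.
  have hswap f w' x' r : injective f -> pfresh w' r -> pfresh c (premap f r) ->
      alpha (premap (transp c (f w') \o f) (pswap r w' x'))
            (pswap (premap f r) c (f x')).
    move=> fi wr zr; apply: alpha_trans (bisim_alpha (bisim_comp _ _ _)) _.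
    apply: alpha_trans _ (alpha_sym (bisim_alpha (bisim_comp _ _ _))).
    apply: alpha_ext.
    + by apply: inj_comp (ti _ _ fi) _; exact: transp_inj.
    + exact: inj_comp (@transp_inj _ _ _) fi.
    move=> v nv /=; case: (pselect (v = x')) => [->|vx]; first by rewrite !transpR.
    have vw : v <> w' by move=> e; apply: nv; rewrite e.
    have vz : f v <> c by move=> e; apply: nv; apply: (@fresh_unmap _ f); rewrite // e.
    by rewrite (@transpD _ w' x') // !transpD // => /fi.
  have hsame f w' r : injective f -> pfresh w' r -> pfresh c (premap f r) ->
      alpha (premap (transp c (f w') \o f) r) (premap f r).
    move=> fi wr zr; apply: alpha_ext => //; first exact: ti.
    move=> v nv /=; rewrite transpD //.
      by move=> e; apply: nv; apply: (@fresh_unmap _ f); rewrite // e.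
    by move=> /fi e; apply: nv; rewrite e.
  split; first by split; exact: ti.
  + split.
      apply: alpha_trans (hswap _ _ _ _ i1 fp gp) _.
      apply: alpha_trans _ (alpha_sym (hswap _ _ _ _ i2 fq gq)).
      by apply: alpha_Lm_inv => //; rewrite -!premapLm.
    apply: alpha_trans (hsame _ _ _ i1 fs1 gs1) _.
    exact: alpha_trans hs (alpha_sym (hsame _ _ _ i2 fs2 gs2)).
  + rewrite /= !transpD // -?hz; try by [move=> /i1/esym|exact: nesym].
    by rewrite hz => /i2/esym.
  + by apply: bisim_trans (bisim_map _ ha') (bisim_comp _ _ _).
  + by apply: bisim_trans (bisim_map _ hb') (bisim_comp _ _ _).
Qed.

Definition psubst (t s : Tr) z : Tr := \pi_Tr (psub (repr s) z (repr t)).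

Lemma bisim_id_alpha p : alpha (premap id p) p.
Proof. exact/bisim_alpha/bisim_id. Qed.

Lemma psub_congr z p q s1 s2 : alpha p q -> alpha s1 s2 ->
  alpha (psub s1 z p) (psub s2 z q).
Proof.
move=> pq s12; apply: alpha_trans (bisim_id_alpha _).
apply: alpha_trans (alpha_sym (bisim_id_alpha _)) _.
by apply: psub_alpha => //; exact: alpha_map.
Qed.

Lemma psubst_pi p s z : psubst (\pi_Tr p) (\pi_Tr s) z = \pi_Tr (psub s z p).
Proof. by apply/iterm_eqP/psub_congr; exact: repr_pi. Qed.

Lemma psubst_is_subst : is_subst psubst.
Proof.
split.
- move=> x s z; rewrite -[s]reprK psubst_pi psub_unfold.
  by case: (x == z); rewrite ?reprK.
- move=> t1 t2 s z; rewrite -[t1]reprK -[t2]reprK -[s]reprK -pi_Ap !psubst_pi.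
  by rewrite [X in \pi_Tr X]psub_unfold pi_Ap.
- move=> x t s z xz; rewrite -[t]reprK -[s]reprK => /pi_fresh fs.
  rewrite -pi_Lm !psubst_pi -pi_Lm; apply/iterm_eqP.
  move: (repr t) (repr s) fs => {t s} p s fs; rewrite psub_unfold /=.
  move: (freshv _) (freshvP [:: p; s; PVr z]) => w /= [fp [fs' [/fresh_var fz _]]].
  have [c /= [g1 [g2 [g3 [g4 [/fresh_var gz _]]]]]] := ex_fresh
    [:: psub s z (pswap p w x); psub s z p; p; s; PVr z].
  apply: (@alpha_Lm _ _ _ c); [by right|by right|].
  apply: psub_alpha; try exact: transp_inj.
  + by apply: alpha_sym; apply: alpha_rebind => //; right.
  + have fix_s v : pfresh v s -> alpha (premap (transp c v) s) s.
      move=> vs; apply: alpha_trans (bisim_id_alpha s).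
      apply: alpha_ext => //; first exact: transp_inj.
      by move=> u nu; rewrite transpD // => e; apply: nu; rewrite e.
    exact: alpha_trans (fix_s _ fs') (alpha_sym (fix_s _ fs)).
  + by rewrite !transpD //; apply: nesym.
Qed.

Lemma iterm_coind (R : Tr -> Tr -> Prop) :
  (forall t u, R t u ->
    [\/ t = u,
        exists t1 t2 u1 u2, [/\ t = Ap t1 t2, u = Ap u1 u2, R t1 u1 & R t2 u2] |
        exists x t' u', [/\ t = Lm x t', u = Lm x u' & R t' u']]) ->
  forall t u : Tr, R t u -> t = u.
Proof.
move=> hR t u tu; rewrite -[t]reprK -[u]reprK; apply/iterm_eqP.
pose S p q := alpha p q \/ exists f p0 q0, [/\ injective f,
  alpha p (premap f p0), alpha q (premap f q0) & R (\pi_Tr p0) (\pi_Tr q0)].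
apply: (@alpha_coind _ S); last first.
  right; exists id, (repr t), (repr u); split; rewrite ?reprK //;
    exact/alpha_sym/bisim_id_alpha.
have alpha_S a b : alpha a b -> alpha_step S a b.
  case/alpha_unfold => *; econstructor; try eassumption; by left.
move=> {t u tu} p q [/alpha_S //|[f [p0 [q0 [fi hp hq /hR]]]]].
case=> [/iterm_eqP e||].
- apply/alpha_S/(alpha_trans hp)/(alpha_trans _ (alpha_sym hq)); exact: alpha_map.
- move=> [t1 [t2 [u1 [u2 [et eu R1 R2]]]]].
  have {}hp : alpha p (premap f (PAp (repr t1) (repr t2))).
    by apply/(alpha_trans hp)/alpha_map/iterm_eqP.
  have {}hq : alpha q (premap f (PAp (repr u1) (repr u2))).
    by apply/(alpha_trans hq)/alpha_map/iterm_eqP.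
  move: hp hq; rewrite !premapE => hp hq; inversion hp; inversion hq; subst.
  constructor; right; [exists f, (repr t1), (repr u1)|exists f, (repr t2), (repr u2)];
    by split; rewrite ?reprK.
- move=> [x [t' [u' [et eu R']]]].
  have {}hp : alpha p (premap f (PLm x (repr t'))).
    by apply/(alpha_trans hp)/alpha_map/iterm_eqP.
  have {}hq : alpha q (premap f (PLm x (repr u'))).
    by apply/(alpha_trans hq)/alpha_map/iterm_eqP.
  move: hp hq; rewrite !premapE; case: p => [?|? ?|a p] hp; try by inversion hp.
  case: q => [?|? ?|b q] hq; try by inversion hq.
  have [c /= [c1 [c2 [c3 [c4 _]]]]] := ex_fresh
    [:: p; q; premap f (repr t'); premap f (repr u')].
  apply: (@step_Lm _ _ _ _ c); [by right|by right|right].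
  exists (transp c (f x) \o f), (repr t'), (repr u'); split; rewrite ?reprK //.
  + exact: inj_comp (@transp_inj _ _ _) fi.
  + exact: alpha_trans (alpha_Lm_inv hp c1 c3) (bisim_alpha (bisim_comp _ _ _)).
  + exact: alpha_trans (alpha_Lm_inv hq c2 c4) (bisim_alpha (bisim_comp _ _ _)).
Qed.

Lemma iterm_cases (t s : Tr) z :
  [\/ exists x, t = Vr x, exists t1 t2, t = Ap t1 t2 |
      exists x t', [/\ x <> z, fresh x s & t = Lm x t']].
Proof.
rewrite -[t]reprK; case: (repr t) => [x|p q|x p].
- by constructor 1; exists x.
- by constructor 2; exists (\pi_Tr p), (\pi_Tr q); exact: pi_Ap.
- constructor 3; have [c /= [c1 [c2 [/fresh_var c3 _]]]] := ex_fresh [:: p; repr s; PVr z].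
  exists c, (\pi_Tr (pswap p c x)); split=> //; rewrite -pi_Lm; apply/iterm_eqP.
  apply: (@alpha_Lm _ _ _ c); [by right|by left|exact/alpha_sym/alpha_swapid].
Qed.

Lemma is_subst_uniq sb1 sb2 : is_subst sb1 -> is_subst sb2 -> sb1 = sb2.
Proof.
move=> [v1 a1 l1] [v2 a2 l2]; apply/funext => t; apply/funext => s; apply/funext => z.
apply: (@iterm_coind (fun a b => exists t, a = sb1 t s z /\ b = sb2 t s z));
  last by exists t.
move=> _ _ [{}t [-> ->]]; have [[x ->]|[t1 [t2 ->]]|[x [t' [xz xs ->]]]] := iterm_cases t s z.
- by constructor 1; rewrite v1 v2.
- constructor 2; exists (sb1 t1 s z), (sb1 t2 s z), (sb2 t1 s z), (sb2 t2 s z).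
  by rewrite a1 a2; split=> //; [exists t1|exists t2].
- constructor 3; exists x, (sb1 t' s z), (sb2 t' s z).
  by rewrite l1 // l2 //; split=> //; exists t'.
Qed.

Lemma subst_exists_unique : exists! sb, is_subst sb.
Proof.
by exists psubst; split=> [|sb]; [exact: psubst_is_subst|exact: is_subst_uniq psubst_is_subst].
Qed.

Definition subst : Tr -> Tr -> Var -> Tr := sval (cid subst_exists_unique).

Lemma subst_is_subst : is_subst subst.
Proof. by rewrite /subst; case: cid => sb /= []. Qed.

Definition rename (t : Tr) y z : Tr := subst t (Vr y) z.

End Subst.

Record category := Category {
  ob :> Type;
  arrow : ob -> ob -> Type;
  arrow_id : forall a, arrow a a;
  arrow_comp : forall a b c, arrow b c -> arrow a b -> arrow a c;
  arrow_comp1l : forall a b (f : arrow a b), arrow_comp (arrow_id b) f = f;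
  arrow_comp1r : forall a b (f : arrow a b), arrow_comp f (arrow_id a) = f;
  arrow_compA : forall a b c d (h : arrow c d) (g : arrow b c) (f : arrow a b),
    arrow_comp h (arrow_comp g f) = arrow_comp (arrow_comp h g) f
}.

Record functor (C D : category) := Functor {
  fob :> C -> D;
  fmap : forall a b : C, arrow a b -> arrow (fob a) (fob b);
  fmap1 : forall a, fmap (arrow_id a) = arrow_id (fob a);
  fmap_comp : forall (a b c : C) (g : arrow b c) (f : arrow a b),
    fmap (arrow_comp g f) = arrow_comp (fmap g) (fmap f)
}.

Definition is_final (C : category) (J : C) : Prop :=
  forall A : C, exists! f : arrow A J, True.

Definition is_epi_corecursor (B : category) (T : B) (C : category) (J : C)
    (R : functor C B) : Prop :=
  is_final J /\ R J = T.

Inductive symbol := sdest | svr | spm | ssw | ssb | sren | sfv | sfr.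

Definition symbol_eq (s1 s2 : symbol) : bool :=
  match s1, s2 with
  | sdest, sdest | svr, svr | spm, spm | ssw, ssw
  | ssb, ssb | sren, sren | sfv, sfv | sfr, sfr => true
  | _, _ => false
  end.

Lemma symbol_eqP : Equality.axiom symbol_eq.
Proof. by case; case; constructor. Qed.

HB.instance Definition _ := hasDecEq.Build symbol symbol_eqP.

Notation signature := (seq symbol).

Definition Sigma_dtor : signature := [:: sdest].

Inductive variant :=
  | perm_free
  | perm_free_variant
  | swap_free_variant
  | swap_fresh_variant
  | swap_fresh
  | subst_fresh
  | renaming
  | renaming_fresh_variant.

Section Models.
Variable Var : varType.

Definition op (s : symbol) (M : Type) : Type :=
  match s with
  | sdest => M -> dtor Var M
  | svr => Var -> M
  | spm => M -> finperm Var -> M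
  | ssw => M -> Var -> Var -> M
  | ssb => M -> M -> Var -> M
  | sren => M -> Var -> Var -> M
  | sfv => M -> set Var
  | sfr => Var -> M -> bool
  end.

Record model (Sg : signature) := Model {
  carrier :> Type;
  interp : forall s, s \in Sg -> op s carrier
}.

Definition preserves (s : symbol) (M M' : Type) (g : M -> M') :
    op s M -> op s M' -> Prop :=
  match s with
  | sdest => fun Dest Dest' => forall m,
      match Dest m with
      | InV x => Dest' (g m) = InV x
      | InA m1 m2 => Dest' (g m) = InA (g m1) (g m2)
      | InL K => exists2 K', Dest' (g m) = InL K' &
          [set (xm.1, g xm.2) | xm in sval K] `<=` sval K'
      end
  | svr => fun Vr Vr' => forall x, g (Vr x) = Vr' x
  | spm => fun pm pm' => forall m f, g (pm m f) = pm' (g m) f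
  | ssw => fun sw sw' => forall m z1 z2, g (sw m z1 z2) = sw' (g m) z1 z2
  | ssb => fun sb sb' => forall m n z, g (sb m n z) = sb' (g m) (g n) z
  | sren => fun ren ren' => forall m y z, g (ren m y z) = ren' (g m) y z
  | sfv => fun FV FV' => forall m, FV' (g m) `<=` FV m
  | sfr => fun fr fr' => forall x m, fr x m -> fr' x (g m)
  end.

Definition is_morphism (Sg : signature) (N N' : model Sg) (g : N -> N') : Prop :=
  forall s (h : s \in Sg), preserves g (interp N h) (interp N' h).

Definition morphism (Sg : signature) (N N' : model Sg) : Type :=
  {g : N -> N' | is_morphism g}.

Lemma id_is_morphism Sg (N : model Sg) : is_morphism (@id N).
Proof.
move=> s h; case: s h => h //=; last by move=> m x.
by move=> m; case: (interp N h m) => // K; exists K => // _ [[x m'] /= Kx <-].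
Qed.

Lemma comp_is_morphism Sg (N1 N2 N3 : model Sg) (g : N2 -> N3) (f : N1 -> N2) :
  is_morphism g -> is_morphism f -> is_morphism (g \o f).
Proof.
move=> hg hf s h; have := hf s h; have := hg s h.
case: s h => h /= {}hg {}hf; try by move=> *; rewrite hf hg.
- move=> m; have := hf m; case: (interp N1 h m) => [x|m1 m2|K].
  + by move=> e; have := hg (f m); rewrite e.
  + by move=> e; have := hg (f m); rewrite e.
  + move=> [K' e KK']; have := hg (f m); rewrite e => -[K'' -> KK''].
    exists K'' => // _ [[x m'] Kx <-]; apply: KK'' => /=.
    by exists (x, f m') => //; apply: KK'; exists (x, m').
- by move=> m x /hg /hf.
- by move=> x m /hf /hg.
Qed.

Definition morphism_id Sg (N : model Sg) : morphism N N :=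
  exist _ id (@id_is_morphism Sg N).

Definition morphism_comp Sg (N1 N2 N3 : model Sg) (g : morphism N2 N3)
    (f : morphism N1 N2) : morphism N1 N3 :=
  exist _ (sval g \o sval f) (comp_is_morphism (svalP g) (svalP f)).

Lemma morphism_eq Sg (N N' : model Sg) (g g' : morphism N N') :
  sval g = sval g' -> g = g'.
Proof. by case: g g' => [g hg] [g' hg'] /= ?; exact: eq_exist. Qed.

Lemma morphism_1l Sg (N N' : model Sg) (f : morphism N N') :
  morphism_comp (morphism_id N') f = f.
Proof. exact: morphism_eq. Qed.

Lemma morphism_1r Sg (N N' : model Sg) (f : morphism N N') :
  morphism_comp f (morphism_id N) = f.
Proof. exact: morphism_eq. Qed.

Lemma morphism_compA Sg (N1 N2 N3 N4 : model Sg) (h : morphism N3 N4)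
    (g : morphism N2 N3) (f : morphism N1 N2) :
  morphism_comp h (morphism_comp g f) = morphism_comp (morphism_comp h g) f.
Proof. exact: morphism_eq. Qed.

(* The full subcategory of the category of models on the objects satisfying
   [P]. *)
Definition models_where (Sg : signature) (P : model Sg -> Prop) : category :=
  @Category {N : model Sg | P N} (fun N N' => morphism (sval N) (sval N'))
    (fun N => morphism_id (sval N))
    (fun N1 N2 N3 g f => morphism_comp g f)
    (fun _ _ f => morphism_1l f) (fun _ _ f => morphism_1r f)
    (fun _ _ _ _ h g f => morphism_compA h g f).

Definition models (Sg : signature) : category :=
  @Category (model Sg) (@morphism Sg) (@morphism_id Sg) (@morphism_comp Sg)
    (fun _ _ f => morphism_1l f) (fun _ _ f => morphism_1r f)
    (fun _ _ _ _ h g f => morphism_compA h g f).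

Definition std_interp (s : symbol) : op s (iterm Var) :=
  match s with
  | sdest => @Dest Var
  | svr => @Vr Var
  | spm => @perm Var
  | ssw => @swap Var
  | ssb => @subst Var
  | sren => @rename Var
  | sfv => @FV Var
  | sfr => fun x t => `[< fresh x t >]
  end.

Definition Tr_model (Sg : signature) : model Sg := Model (fun s _ => std_interp s).

Definition reduct (Sg Sg' : signature) (h : {subset Sg' <= Sg}) (N : model Sg) :
    model Sg' :=
  Model (fun s hs => interp N (h s hs)).

(* A property is a list of symbols and a statement about arbitrary operations
   interpreting these symbols, in the order of the list. *)
Fixpoint on_ops (M : Type) (l : seq symbol) : Type :=
  if l is s :: l' then op s M -> on_ops M l' else Prop.

Record property := Property {
  syms : seq symbol;
  stmt : forall M : Type, on_ops M syms
}.

Arguments Property syms stmt : clear implicits.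

Fixpoint apply_ops (Sg : signature) (N : model Sg) (l : seq symbol) :
    on_ops N l -> {subset l <= Sg} -> Prop :=
  match l with
  | [::] => fun P _ => P
  | s :: l' => fun P h => apply_ops (P (interp N (h s (mem_head s l'))))
      (fun s' hs' => h s' (@mem_behead _ (s :: l') s' hs'))
  end.

(* [holds N P] requires the signature of [N] to contain all the symbols of [P]. *)
Definition holds (Sg : signature) (N : model Sg) (P : property) : Prop :=
  exists h : {subset syms P <= Sg}, apply_ops (stmt P N) h.

Fixpoint satisfies (Sg : signature) (Ps : seq property) (N : model Sg) : Prop :=
  if Ps is P :: Ps' then holds N P /\ satisfies Ps' N else True.

Definition symbols_of (Ps : seq property) : signature :=
  flatten [seq syms P | P <- Ps].

Definition SwVr_inf := Property [:: sdest; ssw] (fun M Dest sw =>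
  forall t x z1 z2, Dest t = InV x -> Dest (sw t z1 z2) = InV (transp z1 z2 x)).

Definition SwAp_inf := Property [:: sdest; ssw] (fun M Dest sw =>
  forall t t1 t2 z1 z2, Dest t = InA t1 t2 ->
    Dest (sw t z1 z2) = InA (sw t1 z1 z2) (sw t2 z1 z2)).

Definition SwLm_inf := Property [:: sdest; ssw] (fun M Dest sw =>
  forall t K z1 z2, Dest t = InL K ->
    exists2 K', Dest (sw t z1 z2) = InL K' &
      forall x t', sval K (x, t') -> sval K' (transp z1 z2 x, sw t' z1 z2)).

Definition SwId := Property [:: ssw] (fun M sw => forall t z, sw t z z = t).

Definition SwIv := Property [:: ssw] (fun M sw =>
  forall t x y, sw (sw t x y) x y = t).

Definition SwCp := Property [:: ssw] (fun M sw =>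
  forall t x y z1 z2,
    sw (sw t x y) z1 z2 = sw (sw t z1 z2) (transp z1 z2 x) (transp z1 z2 y)).

Definition SwFr := Property [:: ssw; sfr] (fun M sw fr =>
  forall t x y, fr x t -> fr y t -> sw t x y = t).

Definition FrSw := Property [:: ssw; sfr] (fun M sw fr =>
  forall t x y z, fr z (sw t x y) <-> fr (transp x y z) t).

Definition SwCg_inf := Property [:: sdest; ssw; sfr] (fun M Dest sw fr =>
  forall t K x1 t1 x2 t2, Dest t = InL K -> sval K (x1, t1) -> sval K (x2, t2) ->
    exists z, [/\ z = x1 \/ fr z t1, z = x2 \/ fr z t2 & sw t1 z x1 = sw t2 z x2]).

Definition SwBvr_inf := Property [:: sdest; ssw; sfr] (fun M Dest sw fr =>
  forall s K x t x' t', Dest s = InL K -> sval K (x, t) -> sval K (x', t') ->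
    (x' = x \/ fr x' t) /\ t' = sw t x' x).

Definition SwBvr_inf2 := Property [:: sdest; ssw; sfv] (fun M Dest sw FV =>
  forall s K x t x' t', Dest s = InL K -> sval K (x, t) -> sval K (x', t') ->
    (x' = x \/ ~ FV t x') /\ t' = sw t x' x).

Definition PmVr_inf := Property [:: sdest; spm] (fun M Dest pm =>
  forall t x f, Dest t = InV x -> Dest (pm t f) = InV (f x)).

Definition PmAp_inf := Property [:: sdest; spm] (fun M Dest pm =>
  forall t t1 t2 f, Dest t = InA t1 t2 ->
    Dest (pm t f) = InA (pm t1 f) (pm t2 f)).

Definition PmLm_inf := Property [:: sdest; spm] (fun M Dest pm =>
  forall t K f, Dest t = InL K ->
    exists2 K', Dest (pm t f) = InL K' &
      forall x t', sval K (x, t') -> sval K' (f x, pm t' f)).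

Definition PmId := Property [:: spm] (fun M pm =>
  forall t, pm t (perm_id Var) = t).

Definition PmCp := Property [:: spm] (fun M pm =>
  forall t f g, pm (pm t f) g = pm t (perm_comp g f)).

Definition PmFv := Property [:: spm; sfv] (fun M pm FV =>
  forall t f, supp f `&` FV t = set0 -> pm t f = t).

Definition PmBvr_inf := Property [:: sdest; spm; sfv] (fun M Dest pm FV =>
  forall s K x t x' t', Dest s = InL K -> sval K (x, t) -> sval K (x', t') ->
    (x' = x \/ ~ FV t x') /\ t' = pm t (perm_transp x' x)).

Definition SbVr_inf := Property [:: sdest; ssb] (fun M Dest sb =>
  forall t s x z, Dest t = InV x ->
    Dest (sb t s z) = if x == z then Dest s else InV x).

Definition SbAp_inf := Property [:: sdest; ssb] (fun M Dest sb =>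
  forall t t1 t2 s z, Dest t = InA t1 t2 ->
    Dest (sb t s z) = InA (sb t1 s z) (sb t2 s z)).

Definition SbLm_inf := Property [:: sdest; ssb; sfr] (fun M Dest sb fr =>
  forall t s K z, Dest t = InL K ->
    exists2 K', Dest (sb t s z) = InL K' &
      forall x t', sval K (x, t') -> x <> z -> fr x s -> sval K' (x, sb t' s z)).

Definition SbId := Property [:: svr; ssb] (fun M Vr sb =>
  forall t z, sb t (Vr z) z = t).

Definition SbChFr := Property [:: svr; ssb; sfr] (fun M Vr sb fr =>
  forall t s x1 x2, fr x2 t -> sb (sb t (Vr x2) x1) s x2 = sb t s x1).

Definition SbCm := Property [:: ssb; sfr] (fun M sb fr =>
  forall t s u x y, x <> y -> fr y s -> fr x u ->
    sb (sb t s x) u y = sb (sb t u y) s x).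

Definition SbFr := Property [:: ssb; sfr] (fun M sb fr =>
  forall t s y, fr y t -> sb t s y = t).

Definition FrSb := Property [:: ssb; sfr] (fun M sb fr =>
  forall t s y z,
    fr z (sb t s y) <-> (z = y \/ fr z t) /\ (fr y t \/ fr z s)).

Definition SbBvr_inf := Property [:: sdest; svr; ssb; sfr] (fun M Dest Vr sb fr =>
  forall s K x t x' t', Dest s = InL K -> sval K (x, t) -> sval K (x', t') ->
    (x' = x \/ fr x' t) /\ t' = sb t (Vr x') x).

Definition SbBvr_inf' := Property [:: sdest; svr; ssb; sfr] (fun M Dest Vr sb fr =>
  forall s K x t x', Dest s = InL K -> sval K (x, t) -> fr x' t ->
    sval K (x', sb t (Vr x') x)).

Definition VrInv := Property [:: sdest; svr] (fun M Dest Vr =>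
  forall t x, Dest t = InV x <-> t = Vr x).

Definition FrVr := Property [:: svr; sfr] (fun M Vr fr =>
  forall z x, z <> x -> fr z (Vr x)).

Definition RnVr_inf := Property [:: sdest; sren] (fun M Dest ren =>
  forall t x y z, Dest t = InV x -> Dest (ren t y z) = InV (var_ren y z x)).

Definition RnAp_inf := Property [:: sdest; sren] (fun M Dest ren =>
  forall t t1 t2 y z, Dest t = InA t1 t2 ->
    Dest (ren t y z) = InA (ren t1 y z) (ren t2 y z)).

Definition RnLm1_inf := Property [:: sdest; sren] (fun M Dest ren =>
  forall t K y z, Dest t = InL K ->
    exists2 K', Dest (ren t y z) = InL K' &
      forall x t', sval K (x, t') -> x <> y -> x <> z -> sval K' (x, ren t' y z)).

Definition RnId := Property [:: sren] (fun M ren => forall t z, ren t z z = t).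

Definition RnIm := Property [:: sren] (fun M ren =>
  forall t x1 x2 y, x1 <> y -> ren (ren t x1 y) x2 y = ren t x1 y).

Definition RnCh := Property [:: sren] (fun M ren =>
  forall t x1 x2 x3 y, y <> x2 ->
    ren (ren (ren t y x2) x2 x1) x3 x2 = ren (ren t y x2) x3 x1).

Definition RnCm := Property [:: sren] (fun M ren =>
  forall t x1 x2 y1 y2, x2 <> y1 -> y1 <> x1 -> x1 <> y2 ->
    ren (ren t x2 x1) y2 y1 = ren (ren t y2 y1) x2 x1).

Definition RnChFr := Property [:: sren; sfr] (fun M ren fr =>
  forall t x1 x2 x3, fr x2 t -> ren (ren t x2 x1) x3 x2 = ren t x3 x1).

Definition RnFr := Property [:: sren; sfr] (fun M ren fr =>
  forall t x y, fr y t -> ren t x y = t).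

Definition FrRn := Property [:: sren; sfr] (fun M ren fr =>
  forall t x y z,
    fr z (ren t x y) <-> (z = y \/ fr z t) /\ (fr y t \/ x <> z)).

Definition FrRn2 := Property [:: sren; sfr] (fun M ren fr =>
  forall t x y z, fr (var_ren x y z) (ren t x y) -> fr z t).

Definition RnBvr_inf := Property [:: sdest; sren; sfr] (fun M Dest ren fr =>
  forall s K x t x' t', Dest s = InL K -> sval K (x, t) -> sval K (x', t') ->
    (x' = x \/ fr x' t) /\ t' = ren t x' x).

Definition RnBvr_inf' := Property [:: sdest; sren; sfr] (fun M Dest ren fr =>
  forall s K x t x', Dest s = InL K -> sval K (x, t) -> fr x' t ->
    sval K (x', ren t x' x)).

Definition FrVr_inf := Property [:: sdest; sfr] (fun M Dest fr =>
  forall t x z, Dest t = InV x -> fr z t -> z <> x).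

Definition FrAp_inf := Property [:: sdest; sfr] (fun M Dest fr =>
  forall t t1 t2 z, Dest t = InA t1 t2 -> fr z t -> fr z t1 /\ fr z t2).

Definition FrLm_inf := Property [:: sdest; sfr] (fun M Dest fr =>
  forall t K x t' z, Dest t = InL K -> sval K (x, t') -> fr z t ->
    z = x \/ fr z t').

Definition FvVr_inf := Property [:: sdest; sfv] (fun M Dest FV =>
  forall t x, Dest t = InV x -> FV t x).

Definition FvAp_inf := Property [:: sdest; sfv] (fun M Dest FV =>
  forall t t1 t2, Dest t = InA t1 t2 -> FV t1 `|` FV t2 `<=` FV t).

Definition FvLm_inf := Property [:: sdest; sfv] (fun M Dest FV =>
  forall t K x t', Dest t = InL K -> sval K (x, t') -> FV t' `\ x `<=` FV t).

Definition FvDPm_inf := Property [:: spm; sfv] (fun M pm FV =>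
  forall t, FV t = [set x | ~ countable [set y | pm t (perm_transp x y) <> t]]).

Definition FvDSw_inf := Property [:: ssw; sfv] (fun M sw FV =>
  forall t, FV t = [set x | ~ countable [set y | sw t x y <> t]]).

Definition FSupFr_inf := Property [:: sfr] (fun M fr =>
  forall t, countable [set x | ~ fr x t]).

Definition FrDRn_inf := Property [:: sren; sfr] (fun M ren fr =>
  forall t x, fr x t <-> countable [set y | ren t y x <> t]).

Definition Props (i : variant) : seq property :=
  match i with
  | perm_free => [:: PmVr_inf; PmAp_inf; PmLm_inf; PmId; PmCp;
      FvDPm_inf; PmBvr_inf]
  | perm_free_variant => [:: PmVr_inf; PmAp_inf; PmLm_inf; PmId;
      PmCp; PmFv; PmBvr_inf; FvVr_inf; FvAp_inf; FvLm_inf]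
  | swap_free_variant => [:: SwVr_inf; SwAp_inf; SwLm_inf; SwId;
      SwIv; SwCp; FvDSw_inf; SwBvr_inf2]
  | swap_fresh_variant => [:: SwVr_inf; SwAp_inf; SwLm_inf; SwId;
      SwIv; SwCp; SwFr; SwBvr_inf; FrVr_inf; FrAp_inf;
      FrLm_inf]
  | swap_fresh => [:: SwVr_inf; SwAp_inf; SwLm_inf; SwId; SwIv;
      SwCp; SwFr; FrSw; SwCg_inf; FrVr_inf; FrAp_inf;
      FrLm_inf]
  | subst_fresh => [:: SbVr_inf; SbAp_inf; SbLm_inf; SbId;
      SbChFr; SbCm; SbFr; FrSb; SbBvr_inf; SbBvr_inf';
      FSupFr_inf; FrVr_inf; FrAp_inf; FrLm_inf; VrInv; FrVr]
  | renaming => [:: RnVr_inf; RnAp_inf; RnLm1_inf; RnId; RnIm;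
      RnCh; RnCm; FrDRn_inf; RnBvr_inf; RnBvr_inf';
      FSupFr_inf; FrRn2]
  | renaming_fresh_variant => [:: RnVr_inf; RnAp_inf; RnLm1_inf;
      RnId; RnChFr; RnCm; RnFr; FrRn; RnBvr_inf;
      RnBvr_inf'; FSupFr_inf; FrVr_inf; FrAp_inf; FrLm_inf]
  end.

Definition Sigma (i : variant) : signature := symbols_of (Props i).

Lemma Sigma_dtor_sub i : {subset Sigma_dtor <= Sigma i}.
Proof. by move=> s; rewrite inE => /eqP ->; case: i. Qed.

Definition base : category := models Sigma_dtor.

Definition extended (i : variant) : category :=
  models_where (satisfies (Sg := Sigma i) (Props i)).

Lemma forget_is_morphism i (N N' : extended i) (g : arrow N N') :
  is_morphism (sval g : reduct (Sigma_dtor_sub i) (sval N) ->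
                        reduct (Sigma_dtor_sub i) (sval N')).
Proof. by move=> s h; exact: (svalP g s (Sigma_dtor_sub i h)). Qed.

Definition forget_fmap i (N N' : extended i) (g : arrow N N') :
    morphism (reduct (Sigma_dtor_sub i) (sval N))
             (reduct (Sigma_dtor_sub i) (sval N')) :=
  exist _ (sval g) (forget_is_morphism g).

Lemma forget_fmap1 i (N : extended i) :
  forget_fmap (arrow_id N) = morphism_id (reduct (Sigma_dtor_sub i) (sval N)).
Proof. exact: morphism_eq. Qed.

Lemma forget_fmap_comp i (N1 N2 N3 : extended i) (g : arrow N2 N3)
    (f : arrow N1 N2) :
  forget_fmap (arrow_comp g f) = morphism_comp (forget_fmap g) (forget_fmap f).
Proof. exact: morphism_eq. Qed.

Definition forget (i : variant) : functor (extended i) base :=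
  @Functor (extended i) base (fun N => reduct (Sigma_dtor_sub i) (sval N))
    (@forget_fmap i) (@forget_fmap1 i) (@forget_fmap_comp i).

End Models.

(* Main.v *)
(* Uniqueness of a morphism into the iterms uses the destructor alone: two
   morphisms take bisimilar values, a binder being chosen from the nonempty set
   [K]. For existence, choosing one pair in each [K] turns a model into a
   coalgebra of pre-iterms, and the corecursive map into pre-iterms must be shown
   independent of the choices up to alpha-equivalence. This works for any model
   with a permutation- or swapping-like action such that two pairs of the same
   [K] are identified after swapping their variables with a suitably fresh one:
   the relation "[m1] after actions [l1] equals [m2] after actions [l2]" is then
   an alpha-bisimulation. Freshness derived from the uncountability condition
   satisfies the laws needed, and the renaming variants reduce to this case by
   setting [t[x /\ y] := t[z/x][x/y][y/z]] with [z] fresh; the substitution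
   variant is a renaming one through [t[y/z] := t[(Vr y)/z]]. *)
From mathcomp Require Import all_boot.
From mathcomp Require Import boolp classical_sets functions cardinality.
Require Import Defs.

Set Implicit Arguments.
Unset Strict Implicit.
Unset Printing Implicit Defensive.

Local Open Scope classical_set_scope.
Local Open Scope quotient_scope.

(** * Coinduction for freshness and facts about finite permutations *)

Lemma pfresh_coind (X : Type) (z : X) (Q : preiterm X -> Prop) :
  (forall p, Q p -> match p with
     | PVr x => z <> x
     | PAp p1 p2 => Q p1 /\ Q p2
     | PLm x p' => z = x \/ Q p'
     end) ->
  forall p, Q p -> pfresh z p.
Proof.
move=> hQ; cofix CH => -[x|p1 p2|x p] /hQ h; constructor=> //.
- exact/CH/(proj1 h).
- exact/CH/(proj2 h).
- by case: h => h; [left|right; exact: CH].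
Qed.

Lemma finperm_eq (X : eqType) (f g : finperm X) : f =1 g -> f = g.
Proof.
case: f g => [f bf ff] [g bg fg] /= /funext fg'; move: bf ff bg fg.
by rewrite fg' => *; congr FinPerm; exact: Prop_irrelevance.
Qed.

Lemma perm_transp_id (X : eqType) (x : X) : perm_transp x x = perm_id X.
Proof. by apply: finperm_eq => y; rewrite /= transp_id. Qed.

Lemma transpC (X : eqType) (x y : X) : transp x y =1 transp y x.
Proof.
move=> z; case: (pselect (z = x)) => [->|zx]; first by rewrite transpL transpR.
by case: (pselect (z = y)) => [->|zy]; rewrite ?transpL ?transpR ?transpD.
Qed.

(** * Choosing variables outside countable sets *)

Section Avoid.
Variables (Var : varType) (T : Type) (fr : Var -> T -> Prop).
Hypothesis fr_countable : forall t, countable [set x | ~ fr x t].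

(** Nested conjunctions compute on concrete lists, so an intro pattern can take them apart. *)
Definition avoids (ts : seq T) (xs : seq Var) (z : Var) : Prop :=
  foldr (fun t P => fr z t /\ P) True ts /\ foldr (fun x P => z <> x /\ P) True xs.

Lemma avoids_countable ts xs : countable [set z | ~ avoids ts xs z].
Proof.
have sub (A B : set Var) : countable B -> A `<=` B -> countable A.
  by move=> cB AB; apply: sub_countable cB; exact: subset_card_le.
apply: (sub _ ([set z | ~ foldr (fun t P => fr z t /\ P) True ts] `|`
               [set z | ~ foldr (fun x P => z <> x /\ P) True xs])); last first.
  by move=> z /= /not_andP.
apply: countable_U.
- elim: ts => [|t ts IH]; first by apply: (sub _ _ (countable0 Var)) => z /= /(_ I).
  by apply: (sub _ _ (countable_U (fr_countable t) IH)) => z /= /not_andP.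
- elim: xs => [|x xs IH]; first by apply: (sub _ _ (countable0 Var)) => z /= /(_ I).
  apply: (sub _ _ (countable_U (countable1 x) IH)) => z /= /not_andP.
  by case=> [/contrapT|]; [left|right].
Qed.

(** [Var] is uncountable, hence not exhausted by the countable set of excluded variables. *)
Lemma ex_avoids ts xs : exists z, avoids ts xs z.
Proof. by have [z /contrapT] := ex_notin (avoids_countable ts xs); exists z. Qed.

End Avoid.

(** * Iterms *)

Section ItermTheory.
Variable Var : varType.
Notation Tr := (iterm Var).
Implicit Types (x y z : Var) (t s u : Tr) (p q : preiterm Var) (f g : finperm Var).

Lemma fresh_countable t : countable [set x | ~ fresh x t].
Proof. exact: countable_FV. Qed.

Lemma fresh_Vr z x : fresh z (Vr x) <-> z <> x.
Proof. by rewrite /Vr pi_fresh; split=> [/fresh_var|]; [|constructor]. Qed.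

Lemma fresh_Ap z t1 t2 : fresh z (Ap t1 t2) <-> fresh z t1 /\ fresh z t2.
Proof.
by rewrite /Ap pi_fresh; split=> [h|[h1 h2]]; [inversion h|constructor].
Qed.

Lemma fresh_Lm z x t : fresh z (Lm x t) <-> z = x \/ fresh z t.
Proof. by rewrite /Lm pi_fresh; split=> h; [inversion h|constructor]. Qed.

(** Pulls [Q] back along the quotient map, so that later proofs need neither representatives nor
    guarded corecursion. *)
Lemma fresh_coind z (Q : Tr -> Prop) :
  (forall x, Q (Vr x) -> z <> x) ->
  (forall t1 t2, Q (Ap t1 t2) -> Q t1 /\ Q t2) ->
  (forall x t, Q (Lm x t) -> z = x \/ Q t) ->
  forall t, Q t -> fresh z t.
Proof.
move=> hV hA hL t; rewrite -[t]reprK pi_fresh.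
apply: (pfresh_coind (Q := fun p => Q (\pi_Tr p))) => -[x|p1 p2|x p].
- exact: hV.
- by rewrite pi_Ap; exact: hA.
- by rewrite pi_Lm; exact: hL.
Qed.

Lemma perm_Vr x f : perm (Vr x) f = Vr (f x).
Proof. by rewrite /Vr -pi_perm /pperm premapE. Qed.

Lemma perm_Ap t1 t2 f : perm (Ap t1 t2) f = Ap (perm t1 f) (perm t2 f).
Proof. by rewrite -[t1]reprK -[t2]reprK -pi_Ap -!pi_perm /pperm premapE pi_Ap. Qed.

Lemma perm_Lm x t f : perm (Lm x t) f = Lm (f x) (perm t f).
Proof. by rewrite -[t]reprK -pi_Lm -!pi_perm /pperm premapE pi_Lm. Qed.

(** This is [alpha_ext] on representatives. The fixing and conjugation laws for swapping below come
    from it. *)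
Lemma perm_ext t f g : (forall x, ~ fresh x t -> f x = g x) -> perm t f = perm t g.
Proof. by move=> fg; apply/iterm_eqP/alpha_ext => //; exact/bij_inj/perm_bij. Qed.

Lemma permI t : perm t (perm_id Var) = t.
Proof. by rewrite -[t]reprK -pi_perm; apply/iterm_eqP; exact/bisim_alpha/bisim_id. Qed.

Lemma permM t f g : perm (perm t f) g = perm t (perm_comp g f).
Proof.
rewrite -[t]reprK; move: (repr t) => p.
by rewrite -(pi_perm p f) -!(pi_perm _ _); apply/iterm_eqP/bisim_alpha/bisim_comp.
Qed.

Lemma perm_fix t f : (forall x, ~ fresh x t -> f x = x) -> perm t f = t.
Proof. by move=> ft; rewrite -[RHS]permI; exact: perm_ext. Qed.

Lemma fresh_perm z t f : fresh (f z) (perm t f) <-> fresh z t.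
Proof.
rewrite -[t]reprK -pi_perm !pi_fresh.
by split=> [/fresh_unmap|/fresh_map]; apply; exact/bij_inj/perm_bij.
Qed.

Lemma swapI t x : swap t x x = t.
Proof. by rewrite -[swap t x x]/(perm t (perm_transp x x)) perm_transp_id permI. Qed.

Lemma swapK t x y : swap (swap t x y) x y = t.
Proof.
rewrite -[LHS]/(perm (perm t (perm_transp x y)) (perm_transp x y)) permM.
by apply: perm_fix => z _ /=; rewrite transpK.
Qed.

Lemma swapC t x y : swap t x y = swap t y x.
Proof. by apply: (@perm_ext t (perm_transp x y) (perm_transp y x)) => z _; exact: transpC. Qed.

Lemma swap_conj t x y z1 z2 : swap (swap t x y) z1 z2 =
  swap (swap t z1 z2) (transp z1 z2 x) (transp z1 z2 y).
Proof.
rewrite -[LHS]/(perm (perm t (perm_transp x y)) (perm_transp z1 z2)).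
rewrite -[RHS]/(perm (perm t (perm_transp z1 z2)) (perm_transp _ _)) !permM.
by apply: perm_ext => z _; exact: esym (transp_map x y (@transp_inj _ z1 z2) z).
Qed.

Lemma swap_fresh_id t x y : fresh x t -> fresh y t -> swap t x y = t.
Proof.
move=> xt yt; apply: (@perm_fix t (perm_transp x y)) => z nz.
by rewrite /= transpD // => e; apply: nz; rewrite e.
Qed.

Lemma fresh_swap_iff t x y z : fresh z (swap t x y) <-> fresh (transp x y z) t.
Proof. by rewrite -(fresh_perm _ t (perm_transp x y)) /= transpK. Qed.

(** In the binder rule of [alpha], [y] itself serves as the common variable; on its own side the
    swapping is then the identity. *)
Lemma Lm_swap x y t : y = x \/ fresh y t -> Lm x t = Lm y (swap t y x).
Proof.
move=> h; rewrite -[t]reprK -pi_swap -!pi_Lm; apply/iterm_eqP.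
apply: (@alpha_Lm _ _ _ y) => //; first by left.
exact/alpha_sym/alpha_swapid.
Qed.

(** The bodies agree after swapping [x] with a variable fresh for both, and swapping is an
    involution. *)
Lemma Lm_inj x t u : Lm x t = Lm x u -> t = u.
Proof.
rewrite -[t]reprK -[u]reprK -!pi_Lm => /iterm_eqP h.
have [z /= [zt [zu _]]] := ex_fresh [:: repr t; repr u].
have := alpha_Lm_inv h zt zu => /iterm_eqP; rewrite !pi_swap => e.
by rewrite -(swapK (\pi _) z x) e swapK.
Qed.

(** A change of binder is exactly a swapping. Freshness of [y] is read off the right-hand term,
    where [y] is bound. *)
Lemma Lm_eqP x y t u :
  Lm x t = Lm y u <-> (y = x \/ fresh y t) /\ u = swap t y x.
Proof.
split=> [e|[h ->]]; last exact: Lm_swap.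
have h : y = x \/ fresh y t by apply/fresh_Lm; rewrite e; apply/fresh_Lm; left.
by split=> //; apply: (@Lm_inj y); rewrite -e (Lm_swap h).
Qed.

(** The variable convention: a binder can be chosen away from any finite data. *)
Lemma iterm_avoid ts xs t : [\/ exists x, t = Vr x, exists t1 t2, t = Ap t1 t2 |
  exists x t', avoids (@fresh Var) ts xs x /\ t = Lm x t'].
Proof.
rewrite -[t]reprK; case: (repr t) => [x|p q|x p].
- by constructor 1; exists x.
- by constructor 2; exists (\pi_Tr p), (\pi_Tr q); exact: pi_Ap.
- constructor 3; have [z [[zp zt] zx]] := ex_avoids fresh_countable (\pi_Tr p :: ts) xs.
  by exists z, (swap (\pi_Tr p) z x); split=> //; rewrite pi_Lm -Lm_swap //; right.
Qed.

(** Coinduction along the pairs [(F t, G t)] with [P t]. The lists [ts] and [xs] hold the parameters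
    that binders avoid, and [P] carries freshness hypotheses down to subterms. *)
Lemma iterm_fun_eq (P : Tr -> Prop) (F G : Tr -> Tr) ts xs :
  (forall x, P (Vr x) -> F (Vr x) = G (Vr x)) ->
  (forall t1 t2, P (Ap t1 t2) -> [/\ P t1, P t2,
     F (Ap t1 t2) = Ap (F t1) (F t2) & G (Ap t1 t2) = Ap (G t1) (G t2)]) ->
  (forall x t, avoids (@fresh Var) ts xs x -> P (Lm x t) -> [/\ P t,
     F (Lm x t) = Lm x (F t) & G (Lm x t) = Lm x (G t)]) ->
  forall t, P t -> F t = G t.
Proof.
move=> hV hA hL t Pt.
apply: (@iterm_coind _ (fun a b => exists t, [/\ P t, a = F t & b = G t]));
  last by exists t.
move=> _ _ [{Pt}t [Pt -> ->]].
have [[x e]|[t1 [t2 e]]|[x [t' [xa e]]]] := iterm_avoid ts xs t; rewrite {t}e in Pt *.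
- by constructor 1; exact: hV.
- have [P1 P2 -> ->] := hA _ _ Pt; constructor 2.
  by exists (F t1), (F t2), (G t1), (G t2); split=> //; [exists t1|exists t2].
- have [P' -> ->] := hL _ _ xa Pt; constructor 3.
  by exists x, (F t'), (G t'); split=> //; exists t'.
Qed.

(** * The destructor, and freshness as a countability condition *)

Lemma Dest_InV t x : Dest t = InV x <-> t = Vr x.
Proof.
split=> [|->]; last exact: Dest_Vr.
have [[y ->]|[t1 [t2 ->]]|[y [t' [_ ->]]]] := iterm_avoid [::] [::] t.
- by rewrite Dest_Vr => -[->].
- by rewrite Dest_Ap.
- by case: (Dest_Lm y t') => h ->.
Qed.

Lemma Dest_InA t t1 t2 : Dest t = InA t1 t2 <-> t = Ap t1 t2.
Proof.
split=> [|->]; last exact: Dest_Ap.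
have [[y ->]|[u1 [u2 ->]]|[y [t' [_ ->]]]] := iterm_avoid [::] [::] t.
- by rewrite Dest_Vr.
- by rewrite Dest_Ap => -[-> ->].
- by case: (Dest_Lm y t') => h ->.
Qed.

Lemma Dest_InL t K x t' : Dest t = InL K -> sval K (x, t') <-> t = Lm x t'.
Proof.
have [[y ->]|[u1 [u2 ->]]|[y [u [_ ->]]]] := iterm_avoid [::] [::] t.
- by rewrite Dest_Vr.
- by rewrite Dest_Ap.
- by case: (Dest_Lm y u) => h -> [<-].
Qed.

Lemma Dest_InL_ex x t : exists2 K, Dest (Lm x t) = InL K &
  forall y u, sval K (y, u) <-> Lm x t = Lm y u.
Proof.
have [h e] := Dest_Lm x t; eexists; first exact: e.
by move=> y u; exact: Dest_InL.
Qed.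

(** By equivariance [z] is fresh for [swap t z w]. This reduces freshness to invariance under one
    swapping. *)
Lemma swap_fixed_fresh t z w : fresh w t -> swap t z w = t -> fresh z t.
Proof. by move=> wt e; rewrite -e; apply/fresh_swap_iff; rewrite transpL. Qed.

(** If [x] is fresh, any [y] with [swap t x y <> t] is among the countably many free variables.
    Conversely, some fresh [y] satisfies [swap t x y = t], and [swap_fixed_fresh] applies. *)
Lemma fresh_swapP x t : fresh x t <-> countable [set y | swap t x y <> t].
Proof.
split=> [xt|h].
  apply: sub_countable (fresh_countable t); apply: subset_card_le => y /= nt yt.
  by apply: nt; exact: swap_fresh_id.
have [y ny] := ex_notin (countable_U h (fresh_countable t)).
by apply: (@swap_fixed_fresh _ _ y); apply: contrapT => ?; apply: ny; [right|left].
Qed.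

(** * Laws of substitution *)

Lemma subst_Vr x s z : subst (Vr x) s z = if x == z then s else Vr x.
Proof. by case: (subst_is_subst Var). Qed.

Lemma subst_Ap t1 t2 s z : subst (Ap t1 t2) s z = Ap (subst t1 s z) (subst t2 s z).
Proof. by case: (subst_is_subst Var). Qed.

Lemma subst_Lm x t s z : x <> z -> fresh x s ->
  subst (Lm x t) s z = Lm x (subst t s z).
Proof. by case: (subst_is_subst Var) => _ _; apply. Qed.

(** Uniqueness of substitution allows computing with [psubst]; the claim is then [psub_alpha] for
    the maps [transp a b] and [id]. *)
Lemma swap_subst t s y a b : swap (subst t s y) a b =
  subst (swap t a b) (swap s a b) (transp a b y).
Proof.
rewrite (is_subst_uniq (subst_is_subst Var) (psubst_is_subst Var)).
rewrite -[t]reprK -[s]reprK; move: (repr t) (repr s) => p q.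
rewrite psubst_pi -(pi_swap p) -(pi_swap q) psubst_pi -(pi_swap (psub q y p)).
apply/iterm_eqP.
apply: alpha_trans (bisim_id_alpha _); apply: psub_alpha => //.
- exact: transp_inj.
- exact/alpha_sym/bisim_id_alpha.
- exact/alpha_sym/bisim_id_alpha.
Qed.

Lemma subst_id t z : subst t (Vr z) z = t.
Proof.
apply: (@iterm_fun_eq (fun _ => True) (fun t => subst t (Vr z) z) id [:: Vr z] [:: z])
  => // [x|t1 t2|x {}t [[xz _] [xz' _]]] _.
- by rewrite subst_Vr; case: eqP => [->|].
- by rewrite subst_Ap.
- by rewrite subst_Lm.
Qed.

Lemma subst_fresh_id t s y : fresh y t -> subst t s y = t.
Proof.
apply: (@iterm_fun_eq (fun t => fresh y t) (fun t => subst t s y) id [:: s] [:: y])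
  => {t} [x /fresh_Vr yx|t1 t2 /fresh_Ap[]|x t [[xs _] [xy _]] /fresh_Lm yt].
- by rewrite subst_Vr; case: eqP => // /esym.
- by rewrite subst_Ap.
- by rewrite subst_Lm //; split=> //; case: yt => // /esym.
Qed.

Lemma swap_fresh_subst t x y : fresh y t -> swap t y x = subst t (Vr y) x.
Proof.
apply: (@iterm_fun_eq (fun t => fresh y t) (fun t => swap t y x)
  (fun t => subst t (Vr y) x) [::] [:: x; y])
  => {t} [z /fresh_Vr yz|t1 t2 /fresh_Ap[]|z t [_ [zx [zy _]]] /fresh_Lm yt].
- rewrite -[LHS]/(perm _ (perm_transp y x)) perm_Vr subst_Vr /=.
  by case: eqP => [->|zx]; rewrite ?transpR // transpD //; exact: nesym.
- by rewrite -[swap (Ap _ _) _ _]/(perm _ (perm_transp y x)) perm_Ap subst_Ap.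
- rewrite -[swap (Lm _ _) _ _]/(perm _ (perm_transp y x)) perm_Lm /= transpD //.
  rewrite subst_Lm //; last exact/fresh_Vr.
  by split=> //; case: yt => // /esym.
Qed.

Lemma subst_chain t s x1 x2 : fresh x2 t ->
  subst (subst t (Vr x2) x1) s x2 = subst t s x1.
Proof.
apply: (@iterm_fun_eq (fun t => fresh x2 t) (fun t => subst (subst t (Vr x2) x1) s x2)
  (fun t => subst t s x1) [:: s] [:: x1; x2])
  => {t} [z /fresh_Vr yz|t1 t2 /fresh_Ap[]|z t [[zs _] [z1 [z2 _]]] /fresh_Lm zt].
- rewrite !subst_Vr; case: eqP => zx; rewrite subst_Vr ?eqxx //.
  by case: eqP => // /esym.
- by rewrite !subst_Ap.
- rewrite !subst_Lm //; last exact/fresh_Vr.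
  by split=> //; case: zt => // /esym.
Qed.

Lemma substC t s u x y : x <> y -> fresh y s -> fresh x u ->
  subst (subst t s x) u y = subst (subst t u y) s x.
Proof.
move=> xy ys xu; apply: (@iterm_fun_eq (fun _ => True)
  (fun t => subst (subst t s x) u y) (fun t => subst (subst t u y) s x)
  [:: s; u] [:: x; y]) => // {t} [z|t1 t2|z t [[zs [zu _]] [zx [zy _]]]] _.
- rewrite !subst_Vr; case: (z =P x) => [->|zx].
    by case: (x =P y) => // _; rewrite subst_Vr eqxx subst_fresh_id.
  rewrite subst_Vr; case: (z =P y) => _; first by rewrite subst_fresh_id.
  by rewrite subst_Vr; case: eqP.
- by rewrite !subst_Ap.
- by rewrite !subst_Lm.
Qed.

(** Swapping [z] with a fresh [w] fixes [t], [s] and [y], hence by equivariance the substitution as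
    well. *)
Lemma fresh_subst_other t s y z : fresh z t -> fresh z s -> z <> y ->
  fresh z (subst t s y).
Proof.
move=> zt zs zy.
have [w [[wt [ws [wst _]]] [wy _]]] :=
  ex_avoids fresh_countable [:: t; s; subst t s y] [:: y].
apply: swap_fixed_fresh wst _.
by rewrite swap_subst !swap_fresh_id // transpD //; exact: nesym.
Qed.

(** Swapping [y] with a fresh [w] gives [t] with [y] renamed to [w] and then [s] substituted for
    [w], which [subst_chain] collapses. *)
Lemma fresh_subst_self t s y : fresh y s -> fresh y (subst t s y).
Proof.
move=> ys; have [w [[wt [ws [wst _]]] [wy _]]] :=
  ex_avoids fresh_countable [:: t; s; subst t s y] [:: y].
apply: swap_fixed_fresh wst _; rewrite swap_subst transpL (swap_fresh_id ys ws).
by rewrite swapC swap_fresh_subst // subst_chain.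
Qed.

(* The binder is moved to a [c] that captures nothing; conjugating [s] and [y]
   instead of [t] keeps the body [t] available for coinduction. *)
Lemma subst_Lm_avoid x t s y z : exists c, [/\ c <> z, c <> y &
  subst (Lm x t) s y = Lm c (swap (subst t (swap s c x) (transp c x y)) c x)].
Proof.
have [c [[ct [cs _]] [cz [cy _]]]] := ex_avoids fresh_countable [:: t; s] [:: z; y].
exists c; split=> //; rewrite (@Lm_swap x c) ?subst_Lm //; last by right.
by rewrite swap_subst swapK transpK.
Qed.

(** Coinduction on [t]. The predicate quantifies over [s] and [y] because passing under a binder
    conjugates both by a swapping. *)
Lemma fresh_of_subst t s y z : z <> y -> fresh z (subst t s y) -> fresh z t.
Proof.
move=> zy zt; apply: (@fresh_coind z (fun t => exists s y, z <> y /\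
  fresh z (subst t s y))); last by exists s, y.
- move=> x [{zy zt}s [{}y [zy]]]; rewrite subst_Vr.
  by case: eqP => [->|_ /fresh_Vr].
- move=> t1 t2 [{zy zt}s [{}y [zy]]]; rewrite subst_Ap => /fresh_Ap[h1 h2].
  by split; exists s, y.
- move=> x {zt}t [{zy}s [{}y [zy]]].
  have [c [cz cy ->]] := subst_Lm_avoid x t s y z; move=> /fresh_Lm[/esym //|].
  move=> /fresh_swap_iff h; case: (pselect (z = x)) => [|zx]; [by left|right].
  move: h; rewrite transpD //; last exact: nesym.
  exists (swap s c x), (transp c x y); split=> //.
  case: (pselect (y = x)) => [->|yx]; first by rewrite transpR; exact: nesym.
  by rewrite transpD //; exact: nesym.
Qed.

(** The same method with [y] as the fixed variable, so that [s] and [z] are conjugated. *)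
Lemma fresh_of_subst_range t s y z : ~ fresh z s -> fresh z (subst t s y) -> fresh y t.
Proof.
move=> zs zt; apply: (@fresh_coind y (fun t => exists s z, ~ fresh z s /\
  fresh z (subst t s y))); last by exists s, z.
- move=> x [{zs zt}s [{}z [zs]]]; rewrite subst_Vr.
  by case: eqP => // xy _ /esym.
- move=> t1 t2 [{zs zt}s [{}z [zs]]]; rewrite subst_Ap => /fresh_Ap[h1 h2].
  by split; exists s, z.
- move=> x {zt}t [{zs}s [{}z [zs]]].
  have [c [cz cy ->]] := subst_Lm_avoid x t s y z; move=> /fresh_Lm[/esym //|].
  move=> /fresh_swap_iff h; case: (pselect (y = x)) => [|yx]; [by left|right].
  exists (swap s c x), (transp c x z); split.
    by move=> /fresh_swap_iff; rewrite transpK.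
  by rewrite -[X in subst t _ X](@transpD _ c x y) //; exact: nesym.
Qed.

Lemma fresh_substP t s y z :
  fresh z (subst t s y) <-> (z = y \/ fresh z t) /\ (fresh y t \/ fresh z s).
Proof.
split=> [h|[h1 [yt|zs]]].
- split; first by case: (pselect (z = y)) => [|zy]; [left|right; exact: fresh_of_subst h].
  case: (pselect (fresh z s)) => [|zs]; [by right|left; exact: fresh_of_subst_range h].
- by rewrite subst_fresh_id //; case: h1 => [->|].
- case: (pselect (z = y)) h1 zs => [->|zy] h1 zs; first exact: fresh_subst_self.
  by case: h1 => // zt; exact: fresh_subst_other.
Qed.

End ItermTheory.

(** * Corecursion into iterms *)

Section Corecursion.
Variables (Var : varType) (M : Type) (D : M -> dtor Var M).
Implicit Types (x y z : Var) (m n : M).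

CoFixpoint pcorec m : preiterm Var :=
  match D m with
  | InV x => PVr x
  | InA m1 m2 => PAp (pcorec m1) (pcorec m2)
  | InL K => let xm := sval (cid (svalP K)) in PLm xm.1 (pcorec xm.2)
  end.

Definition corec m : iterm Var := \pi_(iterm Var) (pcorec m).

Lemma pcorec_unfold m : pcorec m =
  match D m with
  | InV x => PVr x
  | InA m1 m2 => PAp (pcorec m1) (pcorec m2)
  | InL K => let xm := sval (cid (svalP K)) in PLm xm.1 (pcorec xm.2)
  end.
Proof.
rewrite -[LHS](_ : match pcorec m with
  | PVr x => PVr x | PAp a b => PAp a b | PLm x a => PLm x a end = pcorec m).
  by rewrite /=; case: (D m).
by case: (pcorec m).
Qed.

(** Corecursion sees [m] only through [D m]. This covers substitution at a variable, where the
    properties determine only the destructor of the result. *)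
Lemma corec_eq_Dest m n : D m = D n -> corec m = corec n.
Proof. by move=> e; rewrite /corec pcorec_unfold e -pcorec_unfold. Qed.

(** All that is kept of the choice in [pcorec] is that the pair lies in [K]. *)
Lemma pcorecP m :
  match D m with
  | InV x => pcorec m = PVr x
  | InA m1 m2 => pcorec m = PAp (pcorec m1) (pcorec m2)
  | InL K => exists x m', sval K (x, m') /\ pcorec m = PLm x (pcorec m')
  end.
Proof.
rewrite pcorec_unfold; case: (D m) => // K /=.
by case: cid => -[x m'] /= h; exists x, m'.
Qed.

(* The maps [v a] name the actions [act ^~ a], so that permutations and
   swappings (and swappings defined from renamings) are treated at once. Neither
   composition laws nor equivariance of freshness are required. *)
Record equivariant_dtor (A : Type) (v : A -> Var -> Var) (act : M -> A -> M)
    (tr : Var -> Var -> A) (fr : Var -> M -> bool) : Prop := EquivariantDtor {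
  v_tr : forall x y, v (tr x y) = transp x y;
  act_Vr : forall m x a, D m = InV x -> D (act m a) = InV (v a x);
  act_Ap : forall m m1 m2 a, D m = InA m1 m2 ->
    D (act m a) = InA (act m1 a) (act m2 a);
  act_Lm : forall m K a, D m = InL K ->
    exists2 K', D (act m a) = InL K' &
      forall x m', sval K (x, m') -> sval K' (v a x, act m' a);
  act_cong : forall m K x1 m1 x2 m2, D m = InL K ->
    sval K (x1, m1) -> sval K (x2, m2) ->
    exists z, [/\ z = x1 \/ fr z m1, z = x2 \/ fr z m2 &
      act m1 (tr z x1) = act m2 (tr z x2)];
  act_frVr : forall m x z, D m = InV x -> fr z m -> z <> x;
  act_frAp : forall m m1 m2 z, D m = InA m1 m2 -> fr z m -> fr z m1 /\ fr z m2;
  act_frLm : forall m K x m' z, D m = InL K -> sval K (x, m') -> fr z m ->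
    z = x \/ fr z m'
}.

(** * Corecursion for an equivariant destructor *)

Section Equivariant.
Variables (A : Type) (v : A -> Var -> Var) (act : M -> A -> M).
Variables (tr : Var -> Var -> A) (fr : Var -> M -> bool).
Hypothesis eqv : equivariant_dtor v act tr fr.
Implicit Types l : seq A.

Definition acts m l : M := foldl act m l.
Definition vacts l x : Var := foldl (fun x a => v a x) x l.

Lemma acts_Dest m l :
  match D m with
  | InV x => D (acts m l) = InV (vacts l x)
  | InA m1 m2 => D (acts m l) = InA (acts m1 l) (acts m2 l)
  | InL K => exists2 K', D (acts m l) = InL K' &
      forall x m', sval K (x, m') -> sval K' (vacts l x, acts m' l)
  end.
Proof.
elim: l m => [|a l IH] m /=.
  by case: (D m) => // K; exists K.
case e: (D m) => [x|m1 m2|K].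
- by have := IH (act m a); rewrite (act_Vr eqv a e).
- by have := IH (act m a); rewrite (act_Ap eqv a e).
- have [K1 e1 h1] := act_Lm eqv a e; have := IH (act m a); rewrite e1.
  by case=> K' e' h'; exists K' => // x m' /h1 /h'.
Qed.

(** Freshness is assumed for the state reached after the actions, since [fr] is not assumed to be
    equivariant. The coinduction therefore ranges over all [m] and [l]. *)
Lemma pcorec_pfresh z m l p : fr z (acts m l) ->
  bisim p (premap (vacts l) (pcorec m)) -> pfresh z p.
Proof.
move=> zm hp; apply: (pfresh_coind (Q := fun p => exists m l, fr z (acts m l) /\
  bisim p (premap (vacts l) (pcorec m)))); last by exists m, l.
move=> {zm hp m l p} p [m [l [zm]]]; have := acts_Dest m l; have := pcorecP m.
case: (D m) => [x|m1 m2|K].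
- move=> -> e; rewrite premapE => hp; inversion hp; subst; exact (act_frVr eqv e zm).
- move=> -> e; rewrite premapE => hp; inversion hp; subst.
  by have [z1 z2] := act_frAp eqv e zm; split; [exists m1, l|exists m2, l].
- move=> [x [m' [Kx ->]]] [K' e h]; rewrite premapE => hp; inversion hp; subst.
  have [->|z'] := act_frLm eqv e (h _ _ Kx) zm; [by left|right].
  by exists m', l.
Qed.

Lemma bisim_pcorec_swap p z x l m : bisim p (premap (vacts l) (pcorec m)) ->
  bisim (pswap p z x) (premap (vacts (rcons l (tr z x))) (pcorec m)).
Proof.
move=> h; apply: bisim_trans (bisim_map _ h) _.
apply: bisim_trans (bisim_comp _ _ _) _; apply: bisim_ext => y.
by rewrite /vacts foldl_rcons /= (v_tr eqv).
Qed.

(* Since no composition law for [act] is assumed, the bisimulation carries the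
   lists of actions performed so far on either side. *)
Lemma pcorec_alpha m1 m2 l1 l2 : acts m1 l1 = acts m2 l2 ->
  alpha (premap (vacts l1) (pcorec m1)) (premap (vacts l2) (pcorec m2)).
Proof.
move=> e12; pose R p q := exists m1 m2 l1 l2, [/\ acts m1 l1 = acts m2 l2,
  bisim p (premap (vacts l1) (pcorec m1)) & bisim q (premap (vacts l2) (pcorec m2))].
apply: (@alpha_coind _ R); last first.
  by exists m1, m2, l1, l2; split=> //; exact: bisim_refl.
move=> {e12 m1 m2 l1 l2} p q [m1 [m2 [l1 [l2 [e12]]]]].
have := acts_Dest m2 l2; have := acts_Dest m1 l1; rewrite -e12.
have := pcorecP m2; have := pcorecP m1.
case: (D m1) => [x|a1 b1|K1]; case: (D m2) => [y|a2 b2|K2].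
- move=> -> -> -> [xy]; rewrite !premapE xy => hp hq.
  by inversion hp; inversion hq; constructor.
- by move=> _ _ ->.
- by move=> _ _ -> [].
- by move=> _ _ ->.
- move=> -> -> -> [ea eb]; rewrite !premapE => hp hq; inversion hp; inversion hq.
  by constructor; [exists a1, a2, l1, l2|exists b1, b2, l1, l2].
- by move=> _ _ -> [].
- by move=> _ _ [K -> _].
- by move=> _ _ [K -> _].
- move=> [x [a [Kx ->]]] [y [b [Ky ->]]] [K e h1] [K'].
  rewrite e => -[<-] h2; rewrite !premapE => hp hq; inversion hp; inversion hq; subst.
  (* Both sides have reached the same state, so the two transported pairs belong to one [K]. *)
  have [z [zx zy exy]] := act_cong eqv e (h1 _ _ Kx) (h2 _ _ Ky).
  apply: (@step_Lm _ _ _ _ z).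
  + by case: zx => [|zx]; [left|right]; last exact: pcorec_pfresh zx _.
  + by case: zy => [|zy]; [left|right]; last exact: pcorec_pfresh zy _.
  + exists a, b, (rcons l1 (tr z (vacts l1 x))), (rcons l2 (tr z (vacts l2 y))).
    by split; [rewrite /acts !foldl_rcons|exact: bisim_pcorec_swap|
               exact: bisim_pcorec_swap].
Qed.

(** The state [act m a] with no action and the state [m] followed by [a] coincide, so [pcorec_alpha]
    compares their trees. *)
Lemma corec_act m a : corec (act m a) = \pi_(iterm Var) (premap (v a) (pcorec m)).
Proof.
apply/iterm_eqP/(alpha_trans (alpha_sym (bisim_id_alpha _))).
exact: (@pcorec_alpha (act m a) m [::] [:: a]).
Qed.

Lemma corec_fresh z m : fr z m -> fresh z (corec m).
Proof.
move=> zm; apply/pi_fresh/(@pcorec_pfresh z m [::]) => //.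
exact/bisim_sym/bisim_id.
Qed.

Lemma corec_Vr m x : D m = InV x -> corec m = Vr x.
Proof. by move=> e; have := pcorecP m; rewrite e /corec => ->. Qed.

Lemma corec_Ap m m1 m2 : D m = InA m1 m2 -> corec m = Ap (corec m1) (corec m2).
Proof. by move=> e; have := pcorecP m; rewrite e /corec => ->; exact: pi_Ap. Qed.

(** Independence of the choice: [act_cong] relates the chosen pair to the given one and yields the
    variable for the binder rule. *)
Lemma corec_Lm m K x m' : D m = InL K -> sval K (x, m') -> corec m = Lm x (corec m').
Proof.
move=> e Kx; have := pcorecP m; rewrite e => -[y [n [Ky h]]].
rewrite /corec h -pi_Lm; apply/iterm_eqP.
have [z [zx zy exy]] := act_cong eqv e Kx Ky.
have fz u k : z = u \/ fr z k -> z = u \/ pfresh z (pcorec k).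
  by case=> [|/corec_fresh/pi_fresh]; [left|right].
apply: (@alpha_Lm _ _ _ z); [exact: fz zy|exact: fz zx|].
have := @pcorec_alpha n m' [:: tr z y] [:: tr z x] (esym exy).
by rewrite /vacts /= !(v_tr eqv).
Qed.

Lemma corec_Dest : preserves (s := sdest) corec D (@Dest Var).
Proof.
move=> m; case e: (D m) => [x|m1 m2|K].
- by apply/Dest_InV; exact: corec_Vr.
- by apply/Dest_InA; exact: corec_Ap.
- have [[x m'] Kx] := svalP K; rewrite (corec_Lm e Kx).
  have [K' e' hK'] := Dest_InL_ex x (corec m'); exists K' => //.
  move=> _ [[y n] /= Ky <-]; apply/hK'; rewrite -(corec_Lm e Kx).
  exact: corec_Lm e Ky.
Qed.

(** Criterion for an operation to become a substitution, applied to both renaming and substitution.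
    The second hypothesis provides a pair whose binder avoids [ms] and [xs]; there both [F] and
    [subst] pass under the binder. *)
Lemma corec_subst (F : M -> M) u z ms xs :
  (forall m, countable [set x | ~ fr x m]) ->
  (forall m K x y m', D m = InL K -> sval K (x, m') -> fr y m' ->
    exists n, sval K (y, n)) ->
  (forall m x, D m = InV x -> corec (F m) = if x == z then u else Vr x) ->
  (forall m m1 m2, D m = InA m1 m2 -> D (F m) = InA (F m1) (F m2)) ->
  (forall m K, D m = InL K -> exists2 K', D (F m) = InL K' &
    forall x m', sval K (x, m') -> avoids (fun x m => fr x m) ms xs x ->
      [/\ x <> z, fresh x u & sval K' (x, F m')]) ->
  forall m, corec (F m) = subst (corec m) u z.
Proof.
move=> frc bv hV hA hL m.
apply: (@iterm_coind _ (fun a b => a = b \/ exists m, a = corec (F m) /\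
  b = subst (corec m) u z)); last by right; exists m.
move=> {m} a b [->|[m [-> ->]]]; first by constructor 1.
case e: (D m) => [x|m1 m2|K].
- by constructor 1; rewrite (corec_Vr e) subst_Vr (hV _ _ e).
- constructor 2; rewrite (corec_Ap e) subst_Ap (corec_Ap (hA _ _ _ e)).
  by do 4 eexists; split=> //; right; [exists m1|exists m2].
- have [[x0 m0] K0] := svalP K.
  have [x [[x0m hms] hxs]] := ex_avoids frc (m0 :: ms) xs.
  have [m' Kx] := bv _ _ _ _ _ e K0 x0m.
  have [K' e' /(_ _ _ Kx (conj hms hxs))[xz xu K'x]] := hL _ _ e.
  constructor 3; exists x, (corec (F m')), (subst (corec m') u z); split.
  + exact: corec_Lm e' K'x.
  + by rewrite (corec_Lm e Kx) subst_Lm.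
  + by right; exists m'.
Qed.

End Equivariant.

Lemma dest_morphism_unique (g h : M -> iterm Var) :
  preserves (s := sdest) g D (@Dest Var) -> preserves (s := sdest) h D (@Dest Var) ->
  g = h.
Proof.
move=> hg hh; apply/funext => m.
apply: (@iterm_coind _ (fun a b => exists m, a = g m /\ b = h m)); last by exists m.
move=> {m} _ _ [m [-> ->]]; have := hh m; have := hg m.
case: (D m) => [x|m1 m2|K].
- by move=> /Dest_InV -> /Dest_InV ->; constructor 1.
- move=> /Dest_InA -> /Dest_InA ->; constructor 2; do 4 eexists; split=> //.
    by exists m1.
  by exists m2.
- move=> [K1 e1 h1] [K2 e2 h2]; have [[x m'] Kx] := svalP K.
  constructor 3; exists x, (g m'), (h m'); split; last by exists m'.
  + by apply/(Dest_InL _ _ e1)/h1; exists (x, m').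
  + by apply/(Dest_InL _ _ e2)/h2; exists (x, m').
Qed.

(** A renset, that is a set with renaming operators, together with freshness and a destructor. The
    laws are those of the renaming/fresh variant, to which the substitution and renaming variants
    are reduced. *)
Record renset (ren : M -> Var -> Var -> M) (fr : Var -> M -> bool) : Prop := Renset {
  ren_Vr : forall t x y z, D t = InV x -> D (ren t y z) = InV (var_ren y z x);
  ren_Ap : forall t t1 t2 y z, D t = InA t1 t2 ->
    D (ren t y z) = InA (ren t1 y z) (ren t2 y z);
  ren_Lm : forall t K y z, D t = InL K ->
    exists2 K', D (ren t y z) = InL K' &
      forall x t', sval K (x, t') -> x <> y -> x <> z -> sval K' (x, ren t' y z);
  ren_id : forall t z, ren t z z = t;
  ren_chain : forall t x1 x2 x3, fr x2 t -> ren (ren t x2 x1) x3 x2 = ren t x3 x1;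
  ren_comm : forall t x1 x2 y1 y2, x2 <> y1 -> y1 <> x1 -> x1 <> y2 ->
    ren (ren t x2 x1) y2 y1 = ren (ren t y2 y1) x2 x1;
  ren_fresh_id : forall t x y, fr y t -> ren t x y = t;
  fr_ren : forall t x y z,
    fr z (ren t x y) <-> (z = y \/ fr z t) /\ (fr y t \/ x <> z);
  ren_bvr : forall s K x t x' t', D s = InL K -> sval K (x, t) -> sval K (x', t') ->
    (x' = x \/ fr x' t) /\ t' = ren t x' x;
  ren_bvr' : forall s K x t x', D s = InL K -> sval K (x, t) -> fr x' t ->
    sval K (x', ren t x' x);
  fr_countable : forall t, countable [set x | ~ fr x t];
  ren_frVr : forall t x z, D t = InV x -> fr z t -> z <> x;
  ren_frAp : forall t t1 t2 z, D t = InA t1 t2 -> fr z t -> fr z t1 /\ fr z t2;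
  ren_frLm : forall t K x t' z, D t = InL K -> sval K (x, t') -> fr z t ->
    z = x \/ fr z t'
}.

(** * Swapping defined from renaming *)

Section Renset.
Variables (ren : M -> Var -> Var -> M) (fr : Var -> M -> bool).
Hypothesis rs : renset ren fr.
Implicit Types t s : M.

(* Independent of the choice of the fresh [z], see [ren_swapE]. *)
Definition ren_swap t x y : M :=
  let z := sval (cid (ex_avoids (fr_countable rs) [:: t] [:: x; y])) in
  ren (ren (ren t z x) x y) y z.

Lemma fr_ren_other z t x y : fr z t -> x <> z -> fr z (ren t x y).
Proof. by move=> zt xz; apply/(fr_ren rs); split; right. Qed.

Lemma fr_ren_self t x y : x <> y -> fr y (ren t x y).
Proof. by move=> xy; apply/(fr_ren rs); split; [left|right]. Qed.

(** Renaming [x] to [w] is split into a detour through [z]; its second half commutes with the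
    renaming of [y] to [x] and is then absorbed by [ren_chain]. *)
Lemma ren_swapE t x y z : fr z t -> z <> x -> z <> y ->
  ren_swap t x y = ren (ren (ren t z x) x y) y z.
Proof.
rewrite /ren_swap; case: cid => w /= [[wt _] [wx [wy _]]] zt zx zy.
case: (pselect (w = z)) => [->//|wz].
rewrite -(ren_chain rs x w zt) (@ren_comm _ _ rs _ z w y x) //; last exact: nesym.
rewrite (ren_chain rs) //; apply: fr_ren_other; last exact: nesym.
by apply: fr_ren_other => //; exact: nesym.
Qed.

Lemma ren_swap_id t x : ren_swap t x x = t.
Proof.
have [z [[zt _] [zx _]]] := ex_avoids (fr_countable rs) [:: t] [:: x].
by rewrite (ren_swapE zt zx zx) (ren_id rs) (ren_chain rs) // (ren_id rs).
Qed.

Lemma ren_swap_fresh t x y : fr x t -> ren_swap t x y = ren t x y.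
Proof.
move=> xt; have [z [[zt _] [zx [zy _]]]] := ex_avoids (fr_countable rs) [:: t] [:: x; y].
rewrite (ren_swapE zt zx zy) (ren_fresh_id rs _ xt) (ren_fresh_id rs) //.
by apply: fr_ren_other => //; exact: nesym.
Qed.

(** For distinct fresh [z] and [w], both sides equal the renamings of [x] to [z] and [y] to [w]
    followed by [w] to [x] and [z] to [y]; within each half the order is immaterial. *)
Lemma ren_swapC t x y : ren_swap t x y = ren_swap t y x.
Proof.
case: (pselect (x = y)) => [->//|xy].
have [z [[zt _] [zx [zy _]]]] := ex_avoids (fr_countable rs) [:: t] [:: x; y].
have [w [[wt _] [wx [wy [wz _]]]]] :=
  ex_avoids (fr_countable rs) [:: t] [:: x; y; z].
rewrite (ren_swapE zt zx zy) (ren_swapE wt wy wx).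
rewrite -(@ren_chain _ _ rs (ren t w y) x z y); last exact: fr_ren_other.
rewrite (@ren_comm _ _ rs t y w x z) //; last exact: nesym.
rewrite (@ren_comm _ _ rs _ z y w x) //; last exact: nesym.
by rewrite (ren_chain rs) //; apply: fr_ren_other => //; exact: nesym.
Qed.

Lemma var_ren_swap x y z u : z <> x -> z <> y -> z <> u ->
  var_ren y z (var_ren x y (var_ren z x u)) = transp x y u.
Proof.
move=> zx zy zu; rewrite /var_ren /transp.
case: (u =P x) => [_|ux]; first by case: (z =P y); rewrite ?eqxx.
by case: (u =P y) => [_|uy]; case: eqP => // /esym.
Qed.

Lemma ren_swap_Vr t u x y : D t = InV u -> D (ren_swap t x y) = InV (transp x y u).
Proof.
move=> e; have [z [[zt _] [zx [zy _]]]] :=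
  ex_avoids (fr_countable rs) [:: t] [:: x; y].
rewrite (ren_swapE zt zx zy) -(var_ren_swap zx zy (ren_frVr rs e zt)).
by do 3 apply: (ren_Vr rs).
Qed.

Lemma ren_swap_Ap t t1 t2 x y : D t = InA t1 t2 ->
  D (ren_swap t x y) = InA (ren_swap t1 x y) (ren_swap t2 x y).
Proof.
(* By [ren_swapE] a single [z] serves the term and its components. *)
move=> e; have [z [[zt [z1 [z2 _]]] [zx [zy _]]]] :=
  ex_avoids (fr_countable rs) [:: t; t1; t2] [:: x; y].
rewrite (ren_swapE zt zx zy) (ren_swapE z1 zx zy) (ren_swapE z2 zx zy).
by do 3 apply: (ren_Ap rs).
Qed.

Lemma ren_swap_Lm_other t K x y u t' : D t = InL K -> sval K (u, t') ->
  u <> x -> u <> y ->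
  exists2 K', D (ren_swap t x y) = InL K' & sval K' (u, ren_swap t' x y).
Proof.
move=> e Ku ux uy; have [z [[zt [z' _]] [zx [zy [zu _]]]]] :=
  ex_avoids (fr_countable rs) [:: t; t'] [:: x; y; u].
rewrite (ren_swapE zt zx zy) (ren_swapE z' zx zy).
have [K1 e1 /(_ _ _ Ku (nesym zu) ux) h1] := ren_Lm rs z x e.
have [K2 e2 /(_ _ _ h1 ux uy) h2] := ren_Lm rs x y e1.
have [K3 e3 /(_ _ _ h2 uy (nesym zu)) h3] := ren_Lm rs y z e2.
by exists K3.
Qed.

(* The bound variable is first renamed to one that the swapping does not touch. *)
Lemma ren_swap_Lm_left t K x y t' : D t = InL K -> sval K (x, t') ->
  exists2 K', D (ren_swap t x y) = InL K' & sval K' (y, ren_swap t' x y).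
Proof.
move=> e Kx; case: (pselect (x = y)) => [<-|xy].
  by rewrite !ren_swap_id; exists K.
have [w [[wt _] [wx [wy _]]]] := ex_avoids (fr_countable rs) [:: t'] [:: x; y].
have [K' e' h'] := ren_swap_Lm_other e (ren_bvr' rs e Kx wt) wx wy; exists K' => //.
rewrite (ren_swapE wt wx wy); rewrite ren_swap_fresh in h'; last exact: fr_ren_self.
by apply: (ren_bvr' rs e' h'); exact: fr_ren_self.
Qed.

Lemma ren_swap_Lm t K x y : D t = InL K ->
  exists2 K', D (ren_swap t x y) = InL K' &
    forall u t', sval K (u, t') -> sval K' (transp x y u, ren_swap t' x y).
Proof.
(* The destructor determines [K'], so it may be found separately for each pair. *)
move=> e; suff h u t' : sval K (u, t') -> exists2 K', D (ren_swap t x y) = InL K' &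
    sval K' (transp x y u, ren_swap t' x y).
  have [[u0 t0] /h[K' e' _]] := svalP K; exists K' => // u t' /h[K'' ].
  by rewrite e' => -[->].
move=> Ku; case: (pselect (u = x)) => [ux|ux].
  by rewrite ux transpL; rewrite ux in Ku; exact: ren_swap_Lm_left e Ku.
case: (pselect (u = y)) => [uy|uy].
  rewrite uy transpR !(ren_swapC _ x); rewrite uy in Ku.
  exact: ren_swap_Lm_left e Ku.
by rewrite transpD //; exact: ren_swap_Lm_other e Ku ux uy.
Qed.

(** For the congruence clause take [z] fresh for both bodies: the swappings become renamings, which
    [ren_bvr] and [ren_chain] make equal. *)
Lemma renset_equivariant : equivariant_dtor
  (fun xy : Var * Var => transp xy.1 xy.2) (fun t xy => ren_swap t xy.1 xy.2)
  (fun x y => (x, y)) fr.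
Proof.
split=> //=; try by case: rs.
- by move=> t x [y z] e; exact: ren_swap_Vr.
- by move=> t t1 t2 [y z] e; exact: ren_swap_Ap.
- by move=> t K [y z] e; exact: ren_swap_Lm.
- move=> t K x1 t1 x2 t2 e K1 K2.
  have [z [[z1 [z2 _]] _]] := ex_avoids (fr_countable rs) [:: t1; t2] [::].
  exists z; split; [by right|by right|].
  have [h e2] := ren_bvr rs e K1 K2; rewrite !ren_swap_fresh // e2.
  by case: h => [->|h]; [rewrite (ren_id rs)|rewrite (ren_chain rs)].
Qed.

Lemma renset_binder m K x y m' : D m = InL K -> sval K (x, m') -> fr y m' ->
  exists n, sval K (y, n).
Proof. by move=> e Kx ym; exists (ren m' y x); exact: (ren_bvr' rs e). Qed.

(** The four lemmas from here derive the laws of the renaming variant that [renset] does not list,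
    for use on iterms. *)
Lemma renset_ren_Im t x1 x2 y : x1 <> y -> ren (ren t x1 y) x2 y = ren t x1 y.
Proof. by move=> xy; apply/(ren_fresh_id rs)/fr_ren_self. Qed.

Lemma renset_ren_Ch t x1 x2 x3 y : y <> x2 ->
  ren (ren (ren t y x2) x2 x1) x3 x2 = ren (ren t y x2) x3 x1.
Proof. by move=> yx; apply/(ren_chain rs)/fr_ren_self. Qed.

(** If [x] is fresh, the set is empty. Conversely some [y <> x] satisfies [ren t y x = t], and
    renaming [x] away makes it fresh. *)
Lemma renset_fr_def t x : fr x t <-> countable [set y | ren t y x <> t].
Proof.
split=> [xt|/(countable_U (countable1 x))/ex_notin[y ny]].
  apply: sub_countable (countable0 Var); apply: subset_card_le => y /=; apply.
  exact: (ren_fresh_id rs).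
have <- : ren t y x = t by apply: contrapT => h; apply: ny; right.
by apply: fr_ren_self => e; apply: ny; left.
Qed.

Lemma renset_fr_ren2 t x y z : fr (var_ren x y z) (ren t x y) -> fr z t.
Proof.
rewrite /var_ren; case: eqP => [->|zy] /(fr_ren rs)[h1 h2].
  by case: h2 => // /(_ erefl).
by case: h1.
Qed.

Lemma corec_ren m y z : corec (ren m y z) = rename (corec m) y z.
Proof.
have eqv := renset_equivariant.
apply: (corec_subst eqv (F := fun m => ren m y z) (ms := [::]) (xs := [:: y; z])).
- exact: (fr_countable rs).
- exact: renset_binder.
- move=> n x e; rewrite (corec_Vr (ren_Vr rs y z e)) /var_ren.
  by case: eqP.
- by move=> *; exact: (ren_Ap rs).
- move=> n K e; have [K' e' h] := ren_Lm rs y z e; exists K' => // x n' Kx.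
  by move=> [_ [xy [xz _]]]; split=> //; [exact/fresh_Vr|exact: h].
Qed.

End Renset.

End Corecursion.

(** * The standard model *)

Section StandardModel.
Variable Var : varType.
Notation Tr := (iterm Var).
Notation frb := (fun x (t : Tr) => `[< fresh x t >]).

(** * Permutation, swapping and freshness properties of iterms *)

Lemma Tr_PmVr : stmt (PmVr_inf Var) Tr (@Dest Var) (@perm Var).
Proof. by move=> t x f /Dest_InV ->; rewrite perm_Vr Dest_Vr. Qed.

Lemma Tr_PmAp : stmt (PmAp_inf Var) Tr (@Dest Var) (@perm Var).
Proof. by move=> t t1 t2 f /Dest_InA ->; rewrite perm_Ap Dest_Ap. Qed.

Lemma Tr_PmLm : stmt (PmLm_inf Var) Tr (@Dest Var) (@perm Var).
Proof.
move=> t K f e; have [[x0 t0] /(Dest_InL _ _ e) e0] := svalP K.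
have [K' e' hK'] := Dest_InL_ex (f x0) (perm t0 f); exists K'.
  by rewrite e0 perm_Lm.
by move=> x t' /(Dest_InL _ _ e) e1; apply/hK'; rewrite -!perm_Lm -e0 e1.
Qed.

Lemma Tr_PmId : stmt (PmId Var) Tr (@perm Var).
Proof. exact: permI. Qed.

Lemma Tr_PmCp : stmt (PmCp Var) Tr (@perm Var).
Proof. exact: permM. Qed.

Lemma Tr_PmFv : stmt (PmFv Var) Tr (@perm Var) (@FV Var).
Proof.
move=> t f h; apply: perm_fix => x xt; apply: contrapT => /eqP fx.
have : (supp f `&` FV t) x by [].
by rewrite h.
Qed.

Lemma Tr_FvVr : stmt (FvVr_inf Var) Tr (@Dest Var) (@FV Var).
Proof. by move=> t x /Dest_InV -> /fresh_Vr. Qed.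

Lemma Tr_FvAp : stmt (FvAp_inf Var) Tr (@Dest Var) (@FV Var).
Proof. by move=> t t1 t2 /Dest_InA -> x [h|h] /fresh_Ap[]. Qed.

Lemma Tr_FvLm : stmt (FvLm_inf Var) Tr (@Dest Var) (@FV Var).
Proof.
by move=> t K x t' e /(Dest_InL _ _ e) -> y [h yx] /fresh_Lm[].
Qed.

Lemma Tr_SwBvr : stmt (SwBvr_inf Var) Tr (@Dest Var) (@swap Var) frb.
Proof.
move=> s K x t x' t' e /(Dest_InL _ _ e) es /(Dest_InL _ _ e); rewrite es.
move=> /Lm_eqP[h ->].
by split=> //; case: h => [|/asboolP]; [left|right].
Qed.

Lemma Tr_SwVr : stmt (SwVr_inf Var) Tr (@Dest Var) (@swap Var).
Proof. by move=> t x z1 z2; exact: (Tr_PmVr (perm_transp z1 z2)). Qed.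

Lemma Tr_SwAp : stmt (SwAp_inf Var) Tr (@Dest Var) (@swap Var).
Proof. by move=> t t1 t2 z1 z2; exact: (Tr_PmAp (perm_transp z1 z2)). Qed.

Lemma Tr_SwLm : stmt (SwLm_inf Var) Tr (@Dest Var) (@swap Var).
Proof. by move=> t K z1 z2; exact: (Tr_PmLm (perm_transp z1 z2)). Qed.

Lemma Tr_SwId : stmt (SwId Var) Tr (@swap Var).
Proof. exact: swapI. Qed.

Lemma Tr_SwIv : stmt (SwIv Var) Tr (@swap Var).
Proof. exact: swapK. Qed.

Lemma Tr_SwCp : stmt (SwCp Var) Tr (@swap Var).
Proof. exact: swap_conj. Qed.

Lemma Tr_SwFr : stmt (SwFr Var) Tr (@swap Var) frb.
Proof. by move=> t x y /asboolP xt /asboolP; exact: swap_fresh_id. Qed.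

Lemma Tr_FrSw : stmt (FrSw Var) Tr (@swap Var) frb.
Proof. by move=> t x y z; split=> /asboolP/fresh_swap_iff/asboolP. Qed.

Lemma Tr_SwBvr2 : stmt (SwBvr_inf2 Var) Tr (@Dest Var) (@swap Var) (@FV Var).
Proof.
move=> s K x t x' t' e h h'; have [hx ->] := Tr_SwBvr e h h'; split=> //.
by case: hx => [|/asboolP hx]; [left|right].
Qed.

(** [swap t x y] is convertible with [perm t (perm_transp x y)]. *)
Lemma Tr_PmBvr : stmt (PmBvr_inf Var) Tr (@Dest Var) (@perm Var) (@FV Var).
Proof. exact: Tr_SwBvr2. Qed.

Lemma Tr_FvDSw : stmt (FvDSw_inf Var) Tr (@swap Var) (@FV Var).
Proof. by move=> t; apply/seteqP; split=> x /= h /fresh_swapP. Qed.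

Lemma Tr_FvDPm : stmt (FvDPm_inf Var) Tr (@perm Var) (@FV Var).
Proof. exact: Tr_FvDSw. Qed.

Lemma Tr_FrVr_inf : stmt (FrVr_inf Var) Tr (@Dest Var) frb.
Proof. by move=> t x z /Dest_InV -> /asboolP/fresh_Vr. Qed.

Lemma Tr_FrAp_inf : stmt (FrAp_inf Var) Tr (@Dest Var) frb.
Proof.
by move=> t t1 t2 z /Dest_InA -> /asboolP/fresh_Ap[]; split; apply/asboolP.
Qed.

Lemma Tr_FrLm_inf : stmt (FrLm_inf Var) Tr (@Dest Var) frb.
Proof.
move=> t K x t' z e /(Dest_InL _ _ e) -> /asboolP/fresh_Lm[]; [by left|right].
exact/asboolP.
Qed.

(** * Substitution properties of iterms *)

Lemma Tr_SbVr : stmt (SbVr_inf Var) Tr (@Dest Var) (@subst Var).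
Proof.
by move=> t s x z /Dest_InV ->; rewrite subst_Vr; case: (x == z); rewrite ?Dest_Vr.
Qed.

Lemma Tr_SbAp : stmt (SbAp_inf Var) Tr (@Dest Var) (@subst Var).
Proof. by move=> t t1 t2 s z /Dest_InA ->; rewrite subst_Ap Dest_Ap. Qed.

Lemma Tr_SbLm : stmt (SbLm_inf Var) Tr (@Dest Var) (@subst Var) frb.
Proof.
move=> t s K z e; have [[x0 t0] /(Dest_InL _ _ e) e0] := svalP K.
(* The binder [x0] may be [z] or free in [s]; the avoiding binder [c] shows that the result is an
   abstraction anyway. *)
have [c [_ _ ec]] := subst_Lm_avoid x0 t0 s z z; rewrite -e0 in ec.
have [K' e' hK'] := Dest_InL_ex c (swap (subst t0 (swap s c x0) (transp c x0 z)) c x0).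
exists K'; first by rewrite ec.
move=> x t' /(Dest_InL _ _ e) et xz /asboolP xs; apply/hK'.
by rewrite -ec et subst_Lm.
Qed.

Lemma Tr_SbBvr : stmt (SbBvr_inf Var) Tr (@Dest Var) (@Vr Var) (@subst Var) frb.
Proof.
move=> s K x t x' t' e h h'; have [hx ->] := Tr_SwBvr e h h'; split=> //.
case: hx => [->|/asboolP hx]; first by rewrite swapI subst_id.
exact: swap_fresh_subst.
Qed.

Lemma Tr_SbBvr' : stmt (SbBvr_inf' Var) Tr (@Dest Var) (@Vr Var) (@subst Var) frb.
Proof.
move=> s K x t x' e /(Dest_InL _ _ e) es /asboolP x't; apply/(Dest_InL _ _ e).
by rewrite es -swap_fresh_subst //; apply: Lm_swap; right.
Qed.

Lemma Tr_subst_fresh :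
  satisfies (Props Var subst_fresh) (Tr_model Var (Sigma Var subst_fresh)).
Proof.
(* The inclusion of the symbols in the signature is decided by computation. *)
do ![split]; (unshelve eexists; first exact/allP).
- exact: Tr_SbVr.
- exact: Tr_SbAp.
- exact: Tr_SbLm.
- exact: subst_id.
- by move=> t s x1 x2 /asboolP; exact: subst_chain.
- by move=> t s u x y xy /asboolP ys /asboolP; exact: substC.
- by move=> t s y /asboolP; exact: subst_fresh_id.
- by move=> t s y z; rewrite /= !asboolE; exact: fresh_substP.
- exact: Tr_SbBvr.
- exact: Tr_SbBvr'.
- move=> t; rewrite (_ : [set x | _] = FV t); first exact: fresh_countable.
  by apply/seteqP; split=> x h /asboolP.
- exact: Tr_FrVr_inf.
- exact: Tr_FrAp_inf.
- exact: Tr_FrLm_inf.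
- exact: Dest_InV.
- by move=> z x zx; apply/asboolP/fresh_Vr.
Qed.

End StandardModel.

(** * Models and finality *)

Section Models.
Variable Var : varType.
Notation Tr := (iterm Var).

(** [interp] takes a proof that the symbol is in the signature. One operation stands for all such
    proofs, so the properties become statements about named operations. *)
Lemma interp_const Sg (N : model Var Sg) s : s \in Sg ->
  exists o : op Var s N, forall h : s \in Sg, interp N h = o.
Proof.
by move=> hs; exists (interp N hs) => h; congr interp; exact: Prop_irrelevance.
Qed.

(** * Rensets from the substitution and renaming properties *)

Lemma renset_of_subst (N : model Var (Sigma Var subst_fresh)) D vr sb fr :
  (forall h : sdest \in Sigma Var subst_fresh, interp N h = D) ->
  (forall h : svr \in Sigma Var subst_fresh, interp N h = vr) ->
  (forall h : ssb \in Sigma Var subst_fresh, interp N h = sb) ->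
  (forall h : sfr \in Sigma Var subst_fresh, interp N h = fr) ->
  satisfies (Props Var subst_fresh) N ->
  renset D (fun t y z => sb t (vr y) z) fr.
Proof.
move=> eD ev es ef.
move=> [[? +] [[? +] [[? +] [[? +] [[? +] [[? +] [[? +] [[? +] [[? +] [[? +]
  [[? +] [[? +] [[? +] [[? +] [[? +] [[? +] _]]]]]]]]]]]]]]]].
rewrite /= !(eD, ev, es, ef).
move=> SbVr SbAp SbLm SbId SbChFr SbCm SbFr FrSb SbBvr SbBvr' FSup FrVr FrAp FrLm
  VrInv FrVr'.
split=> //.
- move=> t x y z e; rewrite (SbVr _ _ _ _ e) /var_ren.
  by case: eqP => // _; apply/VrInv.
- by move=> t t1 t2 y z; exact: SbAp.
- move=> t K y z e; have [K' e' h] := SbLm _ (vr y) _ z e; exists K' => // x t' Kx xy xz.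
  by apply: h => //; exact: FrVr'.
- by move=> t x1 x2 x3; exact: SbChFr.
- move=> t x1 x2 y1 y2 h1 h2 h3.
  by apply: SbCm; [exact: nesym|apply: FrVr'; exact: nesym|exact: FrVr'].
- by move=> t x y; exact: SbFr.
(* [FrSb] mentions freshness for [vr x], which amounts to being distinct from [x]. *)
- move=> t x y z; rewrite FrSb; suff -> : is_true (fr z (vr x)) <-> x <> z by [].
  split=> [h|h]; last by apply: FrVr'; exact: nesym.
  by apply: nesym; apply: FrVr h; apply/VrInv.
Qed.

Lemma renset_of_renaming_fresh (N : model Var (Sigma Var renaming_fresh_variant)) D ren fr :
  (forall h : sdest \in Sigma Var renaming_fresh_variant, interp N h = D) ->
  (forall h : sren \in Sigma Var renaming_fresh_variant, interp N h = ren) ->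
  (forall h : sfr \in Sigma Var renaming_fresh_variant, interp N h = fr) ->
  satisfies (Props Var renaming_fresh_variant) N -> renset D ren fr.
Proof.
move=> eD er ef.
move=> [[? +] [[? +] [[? +] [[? +] [[? +] [[? +] [[? +] [[? +] [[? +] [[? +]
  [[? +] [[? +] [[? +] [[? +] _]]]]]]]]]]]]]].
by rewrite /= !(eD, er, ef).
Qed.

(* [FrDRn_inf] and [RnIm] make [x] fresh for [t] as soon as a single renaming
   of [x] to some [u <> x] fixes [t]. *)
Lemma renset_of_renaming (N : model Var (Sigma Var renaming)) D ren fr :
  (forall h : sdest \in Sigma Var renaming, interp N h = D) ->
  (forall h : sren \in Sigma Var renaming, interp N h = ren) ->
  (forall h : sfr \in Sigma Var renaming, interp N h = fr) ->
  satisfies (Props Var renaming) N -> renset D ren fr.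
Proof.
move=> eD er ef.
move=> [[? +] [[? +] [[? +] [[? +] [[? +] [[? +] [[? +] [[? +] [[? +] [[? +]
  [[? +] [[? +] _]]]]]]]]]]]].
rewrite /= !(eD, er, ef).
move=> RnVr RnAp RnLm RnId RnIm RnCh RnCm FrD RnBvr RnBvr' FSup FrRn2.
have fixed_fr x u t : u <> x -> ren t u x = t -> fr x t.
  move=> ux e; apply/FrD; apply: sub_countable (countable0 Var).
  by apply: subset_card_le => y /=; apply; rewrite -e RnIm.
have ex_var (x y : Var) : exists u, u <> x /\ u <> y.
  have [u /= h] := ex_notin (countable_U (countable1 x) (countable1 y)).
  by exists u; split=> e; apply: h; [left|right].
have RnFr t x y : fr y t -> ren t x y = t.
  move=> /FrD/(countable_U (countable1 y))/ex_notin[u hu].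
  have e : ren t u y = t by apply: contrapT => h; apply: hu; right.
  by rewrite -{1}e RnIm // => uy; apply: hu; left.
split=> //.
(* Renaming the fresh [x2] changes nothing, so [t] has the form that [RnCh] requires. *)
- move=> t x1 x2 x3 xt; have [y [yx _]] := ex_var x2 x2.
  by rewrite -(RnFr t y x2 xt) RnCh.
(* [FrRn2] reflects freshness of [z] when [z <> y], and for [x = z] it reflects it to [y]. In the
   converse, a renaming of [z] that fixes the term is exhibited. *)
- move=> t x y z; split=> [h|[h1 h2]].
    split.
      case: (pselect (z = y)) => [|zy]; [by left|right].
      by apply: (FrRn2 t x y z); rewrite /var_ren; case: eqP.
    case: (pselect (x = z)) => [xz|]; [left|by right].
    by apply: (FrRn2 t x y y); rewrite /var_ren eqxx xz; rewrite xz in h.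
  case: (pselect (fr y t)) => [yt|yt]; first by rewrite RnFr //; case: h1 => [->|].
  case: h2 => // xz; case: (pselect (z = y)) => [zy|zy].
    have [u [uy _]] := ex_var y y; apply: (fixed_fr z u); first by rewrite zy.
    by rewrite zy RnIm // -zy.
  case: h1 => // zt; have [u [uz uy]] := ex_var z y; apply: (fixed_fr z u) => //.
  by rewrite RnCm //; [rewrite (RnFr t)|exact: nesym].
(* In this and the next two clauses, renaming the fresh [z] to another [u] fixes [t], and the
   destructors before and after are compared. *)
- move=> t x z e zt zx; have [u [uz _]] := ex_var z z.
  by have := RnVr _ _ u z e; rewrite (RnFr _ _ _ zt) e -zx /var_ren eqxx => -[/esym/uz].
- move=> t t1 t2 z e zt; have [u [uz _]] := ex_var z z.
  have := RnAp _ _ _ u z e; rewrite (RnFr _ _ _ zt) e => -[/esym e1 /esym e2].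
  by split; exact: fixed_fr uz _.
- move=> t K x t' z e Kx zt; case: (pselect (z = x)) => [|zx]; [by left|right].
  have [u [uz ux]] := ex_var z x; apply: (fixed_fr z u) => //.
  have [K' ] := RnLm _ _ u z e; rewrite (RnFr _ _ _ zt) e => -[<-].
  move=> /(_ _ _ Kx (nesym ux) (nesym zx)) Kx'.
  (* Both pairs have binder [x] in the same [K], so their bodies are equal. *)
  by have [_ ->] := RnBvr _ _ _ _ _ _ e Kx Kx'; rewrite RnId.
Qed.

(** [rename] is by definition the substitution of a variable, so the substitution properties of
    iterms suffice. *)
Lemma Tr_renset : renset (@Dest Var) (@rename Var) (fun x t => `[< fresh x t >]).
Proof.
exact: (renset_of_subst (N := Tr_model Var (Sigma Var subst_fresh)) _ _ _ _
  (Tr_subst_fresh Var)).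
Qed.

Lemma Tr_renaming : satisfies (Props Var renaming) (Tr_model Var (Sigma Var renaming)).
Proof.
have rs := Tr_renset; do ![split]; (unshelve eexists; first exact/allP) => /=;
  try by case: rs.
- exact: (renset_ren_Im rs).
- exact: (renset_ren_Ch rs).
- exact: (renset_fr_def rs).
- exact: (renset_fr_ren2 rs).
Qed.

Lemma Tr_renaming_fresh : satisfies (Props Var renaming_fresh_variant)
  (Tr_model Var (Sigma Var renaming_fresh_variant)).
Proof.
by have rs := Tr_renset; do ![split]; (unshelve eexists; first exact/allP) => /=;
  case: rs.
Qed.

(** With [x2] as common variable, the swapping of the second body is the identity. *)
Lemma SwBvr_SwCg M D sw fr : stmt (SwId Var) M sw ->
  stmt (SwBvr_inf Var) M D sw fr -> stmt (SwCg_inf Var) M D sw fr.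
Proof.
move=> SwId SwBvr t K x1 t1 x2 t2 e K1 K2; exists x2.
by have [h ->] := SwBvr _ _ _ _ _ _ e K1 K2; split; [|left|rewrite SwId].
Qed.

Lemma Tr_satisfies i : satisfies (Props Var i) (Tr_model Var (Sigma Var i)).
Proof.
case: i; [| | | | |exact: Tr_subst_fresh|exact: Tr_renaming|exact: Tr_renaming_fresh];
  do ![split]; (unshelve eexists; first exact/allP).
- exact: Tr_PmVr.
- exact: Tr_PmAp.
- exact: Tr_PmLm.
- exact: Tr_PmId.
- exact: Tr_PmCp.
- exact: Tr_FvDPm.
- exact: Tr_PmBvr.
- exact: Tr_PmVr.
- exact: Tr_PmAp.
- exact: Tr_PmLm.
- exact: Tr_PmId.
- exact: Tr_PmCp.
- exact: Tr_PmFv.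
- exact: Tr_PmBvr.
- exact: Tr_FvVr.
- exact: Tr_FvAp.
- exact: Tr_FvLm.
- exact: Tr_SwVr.
- exact: Tr_SwAp.
- exact: Tr_SwLm.
- exact: Tr_SwId.
- exact: Tr_SwIv.
- exact: Tr_SwCp.
- exact: Tr_FvDSw.
- exact: Tr_SwBvr2.
- exact: Tr_SwVr.
- exact: Tr_SwAp.
- exact: Tr_SwLm.
- exact: Tr_SwId.
- exact: Tr_SwIv.
- exact: Tr_SwCp.
- exact: Tr_SwFr.
- exact: Tr_SwBvr.
- exact: Tr_FrVr_inf.
- exact: Tr_FrAp_inf.
- exact: Tr_FrLm_inf.
- exact: Tr_SwVr.
- exact: Tr_SwAp.
- exact: Tr_SwLm.
- exact: Tr_SwId.
- exact: Tr_SwIv.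
- exact: Tr_SwCp.
- exact: Tr_SwFr.
- exact: Tr_FrSw.
- exact: (SwBvr_SwCg (@Tr_SwId Var) (@Tr_SwBvr Var)).
- exact: Tr_FrVr_inf.
- exact: Tr_FrAp_inf.
- exact: Tr_FrLm_inf.
Qed.

(** * Equivariant destructors from permutation and swapping properties *)

Section Equivariance.
Variables (M : Type) (D : op Var sdest M).

Lemma equivariant_of_perm pm fr :
  stmt (PmVr_inf Var) M D pm -> stmt (PmAp_inf Var) M D pm ->
  stmt (PmLm_inf Var) M D pm ->
  stmt (SwBvr_inf Var) M D (fun t x y => pm t (perm_transp x y)) fr ->
  stmt (PmId Var) M pm -> stmt (FrVr_inf Var) M D fr ->
  stmt (FrAp_inf Var) M D fr -> stmt (FrLm_inf Var) M D fr ->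
  equivariant_dtor D (@perm_fun Var) pm (@perm_transp Var) fr.
Proof.
move=> PmVr PmAp PmLm SwBvr PmId FrVr FrAp FrLm; split=> //.
have SwId : stmt (SwId Var) M (fun t x y => pm t (perm_transp x y)).
  by move=> t x; rewrite perm_transp_id PmId.
exact: SwBvr_SwCg SwId SwBvr.
Qed.

Lemma equivariant_of_swap sw fr :
  stmt (SwVr_inf Var) M D sw -> stmt (SwAp_inf Var) M D sw ->
  stmt (SwLm_inf Var) M D sw -> stmt (SwCg_inf Var) M D sw fr ->
  stmt (FrVr_inf Var) M D fr -> stmt (FrAp_inf Var) M D fr ->
  stmt (FrLm_inf Var) M D fr ->
  equivariant_dtor D (fun xy : Var * Var => transp xy.1 xy.2)
    (fun t xy => sw t xy.1 xy.2) (fun x y => (x, y)) fr.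
Proof.
move=> SwVr SwAp SwLm SwCg FrVr FrAp FrLm; split=> //.
- by move=> m x [y z]; exact: SwVr.
- by move=> m m1 m2 [y z]; exact: SwAp.
- by move=> m K [y z]; exact: SwLm.
Qed.

(** Lets the signatures with free variables use the freshness expected by [equivariant_dtor]. *)
Definition fr_of_FV (FV : M -> set Var) (x : Var) (t : M) : bool := `[< ~ FV t x >].

Lemma SwBvr2_SwBvr sw FV : stmt (SwBvr_inf2 Var) M D sw FV ->
  stmt (SwBvr_inf Var) M D sw (fr_of_FV FV).
Proof.
move=> h s K x t x' t' e K1 K2; have [h1 ->] := h _ _ _ _ _ _ e K1 K2.
by split=> //; case: h1 => [|h1]; [left|right; exact/asboolP].
Qed.

Section FreshnessFromSwapping.
Variables (sw : op Var ssw M) (FV : op Var sfv M).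
Hypothesis FvD : stmt (FvDSw_inf Var) M sw FV.

Lemma fr_of_FV_swap x t : fr_of_FV FV x t <-> countable [set y | sw t x y <> t].
Proof.
rewrite /fr_of_FV FvD; split=> [/asboolP/contrapT //|h].
by apply/asboolP => /=; apply.
Qed.

(** The exceptional set together with [x] and [z] is still countable. *)
Lemma fr_of_FV_fixed x t z : fr_of_FV FV x t -> exists y,
  [/\ y <> x, y <> z & sw t x y = t].
Proof.
move=> /fr_of_FV_swap h.
have [y hy] := ex_notin (countable_U h (countable_U (countable1 x) (countable1 z))).
exists y; split=> [e|e|]; last (apply: contrapT => e); apply: hy;
  by [right; left|right; right|left].
Qed.

(** If [z] were [x], a swapping of [z] with another [y] that fixes [t] would turn the variable into
    [y]. *)
Lemma FvDSw_FrVr : stmt (SwVr_inf Var) M D sw -> stmt (FrVr_inf Var) M D (fr_of_FV FV).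
Proof.
move=> SwVr t x z e /(fr_of_FV_fixed x)[y [yz _ ty]] zx.
by have := SwVr _ _ z y e; rewrite ty e -zx transpL => -[/esym].
Qed.

(** A swapping that fixes [t] fixes both components, so their exceptional sets lie in that of
    [t]. *)
Lemma FvDSw_FrAp : stmt (SwAp_inf Var) M D sw -> stmt (FrAp_inf Var) M D (fr_of_FV FV).
Proof.
move=> SwAp t t1 t2 z e /fr_of_FV_swap h.
split; apply/fr_of_FV_swap; apply: sub_countable h; apply: subset_card_le => y /= n ty;
  by have := SwAp _ _ _ z y e; rewrite ty e => -[e1 e2]; apply: n.
Qed.

(** For [y <> x], a swapping of [z] and [y] that fixes [t] keeps the binder [x], so the swapped pair
    is in the same [K] and the body is fixed too. The case [y = x] adds one point to the exceptional
    set. *)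
Lemma FvDSw_FrLm : stmt (SwLm_inf Var) M D sw -> stmt (SwId Var) M sw ->
  stmt (SwBvr_inf2 Var) M D sw FV -> stmt (FrLm_inf Var) M D (fr_of_FV FV).
Proof.
move=> SwLm SwId SwBvr t K x t' z e Kx /fr_of_FV_swap h.
case: (pselect (z = x)) => [|zx]; [by left|right]; apply/fr_of_FV_swap.
apply: sub_countable (countable_U (countable1 x) h); apply: subset_card_le => y /= n.
case: (pselect (y = x)) => [|yx]; [by left|right => ty; apply: n].
have [K' + /(_ _ _ Kx)] := SwLm _ _ z y e.
rewrite ty e transpD; [move=> [<-] Kx'|exact: nesym|exact: nesym].
by have [_ ->] := SwBvr _ _ _ _ _ _ e Kx Kx'; rewrite SwId.
Qed.

End FreshnessFromSwapping.

End Equivariance.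

Lemma corec_FV M (D : M -> dtor Var M) A v act tr FV :
  @equivariant_dtor Var M D A v act tr (fr_of_FV FV) ->
  forall m, Defs.FV (corec D m) `<=` FV m.
Proof.
move=> eqv m x xm; apply: contrapT => h; apply: xm.
by apply: (corec_fresh eqv); exact/asboolP.
Qed.

Lemma corec_perm M (D : M -> dtor Var M) pm tr fr :
  equivariant_dtor D (@perm_fun Var) pm tr fr ->
  forall m f, corec D (pm m f) = perm (corec D m) f.
Proof. by move=> eqv m f; rewrite (corec_act eqv) -pi_perm. Qed.

Lemma corec_swap M (D : M -> dtor Var M) sw tr fr :
  equivariant_dtor D (fun xy : Var * Var => transp xy.1 xy.2)
    (fun t xy => sw t xy.1 xy.2) tr fr ->
  forall m x y, corec D (sw m x y) = swap (corec D m) x y.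
Proof. by move=> eqv m x y; rewrite (corec_act eqv m (x, y)) -pi_swap. Qed.

(** * Existence of a morphism for each set of properties *)

Lemma morphism_perm_free (N : model Var (Sigma Var perm_free)) :
  satisfies (Props Var perm_free) N ->
  exists g : N -> Tr_model Var (Sigma Var perm_free), is_morphism g.
Proof.
have [D eD] := interp_const N (isT : sdest \in Sigma Var perm_free).
have [pm eP] := interp_const N (isT : spm \in Sigma Var perm_free).
have [FV eF] := interp_const N (isT : sfv \in Sigma Var perm_free).
move=> [[? +] [[? +] [[? +] [[? +] [[? +] [[? +] [[? +] _]]]]]]].
rewrite /= !(eD, eP, eF) => PmVr PmAp PmLm PmId PmCp FvD PmBvr.
(* Restricted to transpositions the action is a swapping, and [FvD] and [PmBvr] are statements about
   it by conversion. *)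
pose sw t x y := pm t (perm_transp x y).
have SwVr : stmt (SwVr_inf Var) N D sw by move=> t x z1 z2; exact: PmVr.
have SwAp : stmt (SwAp_inf Var) N D sw by move=> t t1 t2 z1 z2; exact: PmAp.
have SwLm : stmt (SwLm_inf Var) N D sw by move=> t K z1 z2; exact: PmLm.
have SwId : stmt (SwId Var) N sw by move=> t x; rewrite /sw perm_transp_id PmId.
have eqv := equivariant_of_perm PmVr PmAp PmLm (SwBvr2_SwBvr PmBvr) PmId
  (FvDSw_FrVr (sw := sw) FvD SwVr) (FvDSw_FrAp (sw := sw) FvD SwAp)
  (FvDSw_FrLm (sw := sw) FvD SwLm SwId PmBvr).
exists (corec D) => s h; case: s h => h //=; rewrite ?(eD, eP, eF).
- exact: corec_Dest eqv.
- exact: corec_perm eqv.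
- exact: corec_FV eqv.
Qed.

Lemma morphism_perm_free_variant (N : model Var (Sigma Var perm_free_variant)) :
  satisfies (Props Var perm_free_variant) N ->
  exists g : N -> Tr_model Var (Sigma Var perm_free_variant), is_morphism g.
Proof.
have [D eD] := interp_const N (isT : sdest \in Sigma Var perm_free_variant).
have [pm eP] := interp_const N (isT : spm \in Sigma Var perm_free_variant).
have [FV eF] := interp_const N (isT : sfv \in Sigma Var perm_free_variant).
move=> [[? +] [[? +] [[? +] [[? +] [[? +] [[? +] [[? +] [[? +] [[? +] [[? +] _]]]]]]]]]].
rewrite /= !(eD, eP, eF).
move=> PmVr PmAp PmLm PmId PmCp PmFv PmBvr FvVr FvAp FvLm.
have eqv : equivariant_dtor D (@perm_fun Var) pm (@perm_transp Var) (fr_of_FV FV).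
  apply: equivariant_of_perm => //; first exact: SwBvr2_SwBvr PmBvr.
  - by move=> t x z e /asboolP zt zx; apply: zt; rewrite zx; exact: FvVr.
  - by move=> t t1 t2 z e /asboolP zt; split; apply/asboolP => zi;
      apply/zt/(FvAp _ _ _ e); [left|right].
  - move=> t K x t' z e Kx /asboolP zt; case: (pselect (z = x)) => [|zx]; [by left|right].
    by apply/asboolP => zt'; apply: zt; exact: (FvLm _ _ _ _ e Kx).
exists (corec D) => s h; case: s h => h //=; rewrite ?(eD, eP, eF).
- exact: corec_Dest eqv.
- exact: corec_perm eqv.
- exact: corec_FV eqv.
Qed.

Lemma morphism_swap_free_variant (N : model Var (Sigma Var swap_free_variant)) :
  satisfies (Props Var swap_free_variant) N ->
  exists g : N -> Tr_model Var (Sigma Var swap_free_variant), is_morphism g.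
Proof.
have [D eD] := interp_const N (isT : sdest \in Sigma Var swap_free_variant).
have [sw eS] := interp_const N (isT : ssw \in Sigma Var swap_free_variant).
have [FV eF] := interp_const N (isT : sfv \in Sigma Var swap_free_variant).
move=> [[? +] [[? +] [[? +] [[? +] [[? +] [[? +] [[? +] [[? +] _]]]]]]]].
rewrite /= !(eD, eS, eF) => SwVr SwAp SwLm SwId SwIv SwCp FvD SwBvr.
have eqv := equivariant_of_swap SwVr SwAp SwLm (SwBvr_SwCg SwId (SwBvr2_SwBvr SwBvr))
  (FvDSw_FrVr FvD SwVr) (FvDSw_FrAp FvD SwAp) (FvDSw_FrLm FvD SwLm SwId SwBvr).
exists (corec D) => s h; case: s h => h //=; rewrite ?(eD, eS, eF).
- exact: corec_Dest eqv.
- exact: corec_swap eqv.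
- exact: corec_FV eqv.
Qed.

Lemma morphism_swap_fresh_variant (N : model Var (Sigma Var swap_fresh_variant)) :
  satisfies (Props Var swap_fresh_variant) N ->
  exists g : N -> Tr_model Var (Sigma Var swap_fresh_variant), is_morphism g.
Proof.
have [D eD] := interp_const N (isT : sdest \in Sigma Var swap_fresh_variant).
have [sw eS] := interp_const N (isT : ssw \in Sigma Var swap_fresh_variant).
have [fr eF] := interp_const N (isT : sfr \in Sigma Var swap_fresh_variant).
move=> [[? +] [[? +] [[? +] [[? +] [[? +] [[? +] [[? +] [[? +] [[? +] [[? +]
  [[? +] _]]]]]]]]]]].
rewrite /= !(eD, eS, eF).
move=> SwVr SwAp SwLm SwId SwIv SwCp SwFr SwBvr FrVr FrAp FrLm.
have eqv := equivariant_of_swap SwVr SwAp SwLm (SwBvr_SwCg SwId SwBvr) FrVr FrAp FrLm.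
exists (corec D) => s h; case: s h => h //=; rewrite ?(eD, eS, eF).
- exact: corec_Dest eqv.
- exact: corec_swap eqv.
- by move=> x m xm; apply/asboolP; exact: corec_fresh eqv _ _ xm.
Qed.

Lemma morphism_swap_fresh (N : model Var (Sigma Var swap_fresh)) :
  satisfies (Props Var swap_fresh) N ->
  exists g : N -> Tr_model Var (Sigma Var swap_fresh), is_morphism g.
Proof.
have [D eD] := interp_const N (isT : sdest \in Sigma Var swap_fresh).
have [sw eS] := interp_const N (isT : ssw \in Sigma Var swap_fresh).
have [fr eF] := interp_const N (isT : sfr \in Sigma Var swap_fresh).
move=> [[? +] [[? +] [[? +] [[? +] [[? +] [[? +] [[? +] [[? +] [[? +] [[? +]
  [[? +] [[? +] _]]]]]]]]]]]].
rewrite /= !(eD, eS, eF).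
move=> SwVr SwAp SwLm SwId SwIv SwCp SwFr FrSw SwCg FrVr FrAp FrLm.
have eqv := equivariant_of_swap SwVr SwAp SwLm SwCg FrVr FrAp FrLm.
exists (corec D) => s h; case: s h => h //=; rewrite ?(eD, eS, eF).
- exact: corec_Dest eqv.
- exact: corec_swap eqv.
- by move=> x m xm; apply/asboolP; exact: corec_fresh eqv _ _ xm.
Qed.

Lemma morphism_subst_fresh (N : model Var (Sigma Var subst_fresh)) :
  satisfies (Props Var subst_fresh) N ->
  exists g : N -> Tr_model Var (Sigma Var subst_fresh), is_morphism g.
Proof.
have [D eD] := interp_const N (isT : sdest \in Sigma Var subst_fresh).
have [vr eV] := interp_const N (isT : svr \in Sigma Var subst_fresh).
have [sb eS] := interp_const N (isT : ssb \in Sigma Var subst_fresh).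
have [fr eF] := interp_const N (isT : sfr \in Sigma Var subst_fresh).
move=> sat; have rs := renset_of_subst eD eV eS eF sat.
have eqv := renset_equivariant rs; move: sat.
move=> [[? +] [[? +] [[? +] [_ [_ [_ [_ [_ [_ [_ [_ [_ [_ [_ [[? +] _]]]]]]]]]]]]]]].
rewrite /= !(eD, eV, eS, eF) => SbVr SbAp SbLm VrInv.
exists (corec D) => s h; case: s h => h //=; rewrite ?(eD, eV, eS, eF).
- exact: corec_Dest eqv.
- by move=> x; apply: corec_Vr; exact/VrInv.
- move=> m n z.
  (* Binders must avoid [n] and [z]; the derived renset supplies them. *)
  apply: (corec_subst eqv (F := fun m => sb m n z) (ms := [:: n]) (xs := [:: z])).
  + exact: (fr_countable rs).
  + exact: (renset_binder rs).
  (* At the variable [z] only the destructor of the result is known, namely that of [n]. *)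
  + move=> k x e; have := SbVr _ n _ z e.
    by case: eqP => _ e'; [exact: corec_eq_Dest|exact: corec_Vr].
  + by move=> k k1 k2; exact: SbAp.
  + move=> k K e; have [K' e' hK'] := SbLm _ n _ z e; exists K' => //.
    move=> x k' Kx [[xn _] [xz _]]; split=> //; last exact: hK'.
    exact: (corec_fresh eqv).
- by move=> x m xm; apply/asboolP; exact: corec_fresh eqv _ _ xm.
Qed.

Lemma morphism_renaming (N : model Var (Sigma Var renaming)) :
  satisfies (Props Var renaming) N ->
  exists g : N -> Tr_model Var (Sigma Var renaming), is_morphism g.
Proof.
have [D eD] := interp_const N (isT : sdest \in Sigma Var renaming).
have [ren eR] := interp_const N (isT : sren \in Sigma Var renaming).
have [fr eF] := interp_const N (isT : sfr \in Sigma Var renaming).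
move=> /(renset_of_renaming eD eR eF) rs; have eqv := renset_equivariant rs.
exists (corec D) => s h; case: s h => h //=; rewrite ?(eD, eR, eF).
- exact: corec_Dest eqv.
- exact: corec_ren rs.
- by move=> x m xm; apply/asboolP; exact: corec_fresh eqv _ _ xm.
Qed.

Lemma morphism_renaming_fresh (N : model Var (Sigma Var renaming_fresh_variant)) :
  satisfies (Props Var renaming_fresh_variant) N ->
  exists g : N -> Tr_model Var (Sigma Var renaming_fresh_variant), is_morphism g.
Proof.
have [D eD] := interp_const N (isT : sdest \in Sigma Var renaming_fresh_variant).
have [ren eR] := interp_const N (isT : sren \in Sigma Var renaming_fresh_variant).
have [fr eF] := interp_const N (isT : sfr \in Sigma Var renaming_fresh_variant).
move=> /(renset_of_renaming_fresh eD eR eF) rs; have eqv := renset_equivariant rs.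
exists (corec D) => s h; case: s h => h //=; rewrite ?(eD, eR, eF).
- exact: corec_Dest eqv.
- exact: corec_ren rs.
- by move=> x m xm; apply/asboolP; exact: corec_fresh eqv _ _ xm.
Qed.

(** * Finality and the epi-corecursors *)

Lemma Tr_final i (hJ : satisfies (Props Var i) (Tr_model Var (Sigma Var i))) :
  is_final (exist _ (Tr_model Var (Sigma Var i)) hJ : extended Var i).
Proof.
move=> [N hN].
have [g hg] : exists g : N -> Tr_model Var (Sigma Var i), is_morphism g.
  case: i {hJ} N hN => N; [exact: morphism_perm_free|exact: morphism_perm_free_variant|
    exact: morphism_swap_free_variant|exact: morphism_swap_fresh_variant|
    exact: morphism_swap_fresh|exact: morphism_subst_fresh|exact: morphism_renaming|
    exact: morphism_renaming_fresh].
exists (exist _ g hg); split=> // -[g' hg'] _; apply: morphism_eq => /=.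
have hd : sdest \in Sigma Var i by apply: Sigma_dtor_sub; rewrite mem_head.
exact: dest_morphism_unique (hg _ hd) (hg' _ hd).
Qed.

End Models.

Unset Implicit Arguments.

Theorem mainTheorem7 (Var : varType) (i : variant) :
  exists hJ : satisfies (Props Var i) (Tr_model Var (Sigma Var i)),
    is_epi_corecursor
      (Tr_model Var Sigma_dtor : base Var)
      (exist _ (Tr_model Var (Sigma Var i)) hJ : extended Var i)
      (forget Var i).
Proof.
(* The equation [R J = T] holds by computation, as the standard operations do not depend on the
   signature. *)
by exists (Tr_satisfies Var i); split; [exact: Tr_final|].
Qed.
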